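(* Let $F \subset T$ be a $G_\delta$ subset of $T$ of Lebesgue (arc-length) measure zero. Then there exists $f \in H^\infty$ such that $\operatorname{Re} f(z) > 0$ for all $z \in \Delta$ (in particular $f$ has no zeros in $\Delta$), every point of $T$ is a Fatou point of $f$, and the radial limit $f(\zeta)$ equals $0$ if and only if $\zeta \in F$.
   Context: $\Delta = \{z \in \mathbb{C} : |z|<1\}$ is the open unit disc and $T = \{|z|=1\}$ is the unit circle. $H^\infty$ denotes the space of bounded analytic functions on $\Delta$. For $f \in H^\infty$ and $\zeta \in T$, the radial limit of $f$ at $\zeta$ is $f(\zeta) := \lim_{r \to 1^-} f(r\zeta)$ when this limit exists (as a finite complex number); $\zeta$ is called a Fatou point of $f$ if this radial limit exists. A $G_\delta$ subset of $T$ is a countable intersection of relatively open subsets of $T$. *)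

(* Defs.v *)
From Stdlib Require Import Reals Lra.
Open Scope R_scope.

Definition Cplx := (R * R)%type.
Definition Cre (z : Cplx) : R := fst z.
Definition Cim (z : Cplx) : R := snd z.
Definition Cadd (z w : Cplx) : Cplx := (fst z + fst w, snd z + snd w).
Definition Csub (z w : Cplx) : Cplx := (fst z - fst w, snd z - snd w).
Definition Cmul (z w : Cplx) : Cplx :=
  (fst z * fst w - snd z * snd w, fst z * snd w + snd z * fst w).
Definition Cscal (r : R) (z : Cplx) : Cplx := (r * fst z, r * snd z).
Definition Cmod (z : Cplx) : R := sqrt (fst z * fst z + snd z * snd z).
Definition C0 : Cplx := (0, 0).

Definition in_disc (z : Cplx) : Prop := Cmod z < 1.
Definition on_circle (z : Cplx) : Prop := Cmod z = 1.

Definition C_differentiable_at (f : Cplx -> Cplx) (z : Cplx) : Prop :=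
  exists L : Cplx, forall eps : R, 0 < eps -> exists delta : R, 0 < delta /\
    forall h : Cplx, Cmod h < delta ->
      Cmod (Csub (Csub (f (Cadd z h)) (f z)) (Cmul L h)) <= eps * Cmod h.

Definition H_infty (f : Cplx -> Cplx) : Prop :=
  (forall z, in_disc z -> C_differentiable_at f z) /\
  (exists M : R, forall z, in_disc z -> Cmod (f z) <= M).

Definition radial_limit (f : Cplx -> Cplx) (zeta w : Cplx) : Prop :=
  forall eps : R, 0 < eps -> exists delta : R, 0 < delta /\
    forall r : R, 1 - delta < r < 1 -> Cmod (Csub (f (Cscal r zeta)) w) < eps.

Definition fatou_point (f : Cplx -> Cplx) (zeta : Cplx) : Prop :=
  exists w : Cplx, radial_limit f zeta w.

Definition rel_open_T (U : Cplx -> Prop) : Prop :=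
  forall p, on_circle p -> U p -> exists eps, 0 < eps /\
    forall q, on_circle q -> Cmod (Csub q p) < eps -> U q.

Definition G_delta_T (F : Cplx -> Prop) : Prop :=
  exists U : nat -> (Cplx -> Prop), (forall n, rel_open_T (U n)) /\
    forall z, on_circle z -> (F z <-> forall n, U n z).

(* arc-length (Lebesgue) null subset of T: the parameter set
   { t in [0, 2 pi] | e^{it} in F } has Lebesgue outer measure zero *)
Definition arc_null (F : Cplx -> Prop) : Prop :=
  forall eps : R, 0 < eps -> exists a b : nat -> R,
    (forall n, a n <= b n) /\
    (forall t, 0 <= t <= 2 * PI -> F (cos t, sin t) -> exists n, a n < t < b n) /\
    (forall N, sum_f_R0 (fun n => b n - a n) N <= eps).

(* Main.v *)
(** For a finite family of arcs with centers [c] and radii [rho] put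
    [P z = sum rho / (1 + rho - conj c * z)], a function of positive real part whose size at the origin
    is the total length of the arcs, and [B = P / (1 + P)].  By a weak-type estimate for the radial
    maximal function of [P], the points where it exceeds [1 / N] are covered by another finite family
    of small total length, to which the construction is applied again.  The average [G] of [N]
    successive functions [B] has positive real part, is at least [1 / 5] in real part on the initial
    arcs, is small if these are short, and satisfies [|G (r zeta)| <= 5 Re (G zeta) + 6 / N].

    Given a null set [F] inside an open set [U], cover [F] infinitely often by finite blocks of arcs
    whose centers have controlled distance to the complement of [U], take the functions [G_m] of these
    blocks, and let [f_U = 1 / (1 + sum G_m)].  At a point where [sum Re G_m] diverges, in particular
    on [F], [f_U] has radial limit [0]; elsewhere the domination above makes the sum converge along the
    radius, and the limit of [f_U] has positive real part.  The second case occurs off [U].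
    If [F] is the intersection of the [U_n], then [f = sum 2^-(n+1) f_(U_n)] is as required. *)

Require Import Defs.
From Stdlib Require Import Reals Lra Lia ZArith List Classical ClassicalEpsilon Cantor.
From Coquelicot Require Import Coquelicot.
Import ListNotations.
Open Scope R_scope.

(** A radial limit is demanded at every point of the circle, so convergence almost everywhere is not
    enough: the size along each radius has to be controlled by the boundary value at its endpoint. A
    single [B] has no such control, since it can be large inside the disc below a point where [Re B]
    nearly vanishes. Passing to the next family repairs this, as that family covers all such points:
    [|B_k (r zeta)| <= 5 Re (B_(k+1) zeta) + 1 / N]. Summed over [k], both sides involve the same
    functions up to a shift of the index, which costs one term; averaging reduces this cost to order
    [1 / N]. Each [N] is fixed before its arcs are shortened, so the errors can be made summable.
    The weak-type estimate has to treat [|P|], not only [Re P]. Hence the use of [P / (P + l)],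
    whose real part lies in [[0, 1]], is at least [1 / 2] where [|P| >= l], and is at most the total
    length divided by [l] at the origin. Finite families keep these functions analytic up to the
    circle, so that the integrals are Riemann integrals of Lipschitz functions. *)

(** * Inequalities for the complex modulus *)

Lemma Cmod_le_sqr (z : C) (x : R) : 0 <= x -> Re z ^ 2 + Im z ^ 2 <= x ^ 2 -> Cmod z <= x.
Proof.
  intros Hx H. rewrite <- Cmod2_alt in H.
  apply Rsqr_incr_0_var; unfold Rsqr; nra.
Qed.

Lemma Cmod_ge_sqr (z : C) (x : R) : x ^ 2 <= Re z ^ 2 + Im z ^ 2 -> x <= Cmod z.
Proof.
  intros H. rewrite <- Cmod2_alt in H. pose proof (Cmod_ge_0 z).
  apply Rsqr_incr_0_var; unfold Rsqr; nra.
Qed.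

Lemma Re_le_Cmod (z : C) : Re z <= Cmod z.
Proof. apply Rle_trans with (2 := re_le_Cmod z), Rle_abs. Qed.

Lemma im_le_Cmod (z : C) : Rabs (Im z) <= Cmod z.
Proof. eapply Rle_trans; [apply Rmax_r | apply Rmax_Cmod]. Qed.

Lemma Cmod_le_Re_Im (z : C) : Cmod z <= Rabs (Re z) + Rabs (Im z).
Proof.
  pose proof (Rabs_pos (Re z)). pose proof (Rabs_pos (Im z)).
  apply Cmod_le_sqr; [lra|].
  rewrite <- (pow2_abs (Re z)), <- (pow2_abs (Im z)). nra.
Qed.

Lemma Cmod_sub_sym (z w : C) : Cmod (z - w)%C = Cmod (w - z)%C.
Proof. rewrite <- Cmod_opp. f_equal. ring. Qed.

Lemma Cmod_triangle_sub (a b c : C) : Cmod (a - c)%C <= Cmod (a - b)%C + Cmod (b - c)%C.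
Proof. replace (a - c)%C with ((a - b) + (b - c))%C by ring. apply Cmod_triangle. Qed.

Lemma Cmod_sub_le (z w : C) : Cmod (z - w)%C <= Cmod z + Cmod w.
Proof. rewrite <- (Cmod_opp w). apply Cmod_triangle. Qed.

Lemma Cmod_rev_triangle (z w : C) : Cmod z - Cmod w <= Cmod (z - w)%C.
Proof.
  replace z with ((z - w) + w)%C at 1 by ring.
  pose proof (Cmod_triangle (z - w)%C w). lra.
Qed.

Lemma re_minus (a b : C) : Re (a - b)%C = Re a - Re b.
Proof. reflexivity. Qed.

Lemma Re_pos_neq_0 (z : C) : 0 < Re z -> z <> 0.
Proof. intros H E. rewrite E in H. simpl in H. lra. Qed.

Lemma Re_inv (z : C) : Re (/ z)%C = Re z / Cmod z ^ 2.
Proof. rewrite Cmod2_alt. reflexivity. Qed.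

Lemma Re_inv_pos (z : C) : 0 < Re z -> 0 < Re (/ z)%C.
Proof.
  intros H. rewrite Re_inv. pose proof (Re_le_Cmod z).
  apply Rdiv_lt_0_compat; [assumption | nra].
Qed.

Lemma conj_mul_self (c : C) : Cmod c = 1 -> (Cconj c * c = 1)%C.
Proof.
  intros Hc. rewrite Cmult_comm, <- Cmod2_conj, Hc. rewrite pow1. reflexivity.
Qed.

Lemma Cmod_one_sub_conj (c z : C) : Cmod c = 1 -> Cmod (1 - Cconj c * z)%C = Cmod (z - c)%C.
Proof.
  intros Hc.
  replace (1 - Cconj c * z)%C with (- (Cconj c * (z - c)))%C.
  - rewrite Cmod_opp, Cmod_mult, Cmod_conj, Hc. ring.
  - replace (Cconj c * (z - c))%C with (Cconj c * z - Cconj c * c)%C by ring.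
    rewrite (conj_mul_self c Hc). ring.
Qed.

Lemma Re_one_sub_conj (c z : C) : Cmod c = 1 -> 1 - Cmod z <= Re (1 - Cconj c * z)%C.
Proof.
  intros Hc. rewrite re_minus, re_RtoC.
  pose proof (Re_le_Cmod (Cconj c * z)%C) as H.
  rewrite Cmod_mult, Cmod_conj, Hc in H. lra.
Qed.

(* By the triangle inequality, since [r zeta] is at distance at least [1 - r] from [c]. *)
Lemma Cmod_radial_sub (c zeta : C) (r : R) : Cmod c = 1 -> Cmod zeta = 1 -> 0 <= r <= 1 ->
  Cmod (zeta - c)%C <= 2 * Cmod (r * zeta - c)%C.
Proof.
  intros Hc Hz Hr.
  pose proof (Cmod_triangle_sub zeta (r * zeta)%C c) as H1.
  assert (H2 : Cmod (zeta - r * zeta)%C = 1 - r).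
  { replace (zeta - r * zeta)%C with (RtoC (1 - r) * zeta)%C by (rewrite RtoC_minus; ring).
    rewrite Cmod_mult, Hz, Cmod_R, Rabs_pos_eq; lra. }
  pose proof (Cmod_rev_triangle c (r * zeta)%C) as H3.
  rewrite Cmod_sub_sym, Cmod_mult, Hc, Hz, Cmod_R, Rabs_pos_eq in H3; lra.
Qed.

Lemma Cmod_radial (r : R) (zeta : C) : Cmod zeta = 1 -> 0 <= r -> Cmod (r * zeta)%C = r.
Proof. intros H Hr. rewrite Cmod_mult, H, Cmod_R, Rabs_pos_eq; lra. Qed.

(** * Quantitative analyticity *)

(* A form of complex differentiability on [|z| <= rad] whose constant [M] adds up in series. *)
Definition qana (rad M : R) (F : C -> C) : Prop := exists F' : C -> C,
  (forall z, Cmod z <= rad -> Cmod (F z) <= M /\ Cmod (F' z) <= M) /\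
  (forall z w, Cmod z <= rad -> Cmod w <= rad ->
     Cmod (F w - F z - F' z * (w - z))%C <= M * Cmod (w - z)%C ^ 2).

Lemma qana_weaken (rad M N : R) F : M <= N -> qana rad M F -> qana rad N F.
Proof.
  intros H [F' [H1 H2]]. exists F'. split.
  - intros z Hz. destruct (H1 z Hz). lra.
  - intros z w Hz Hw. eapply Rle_trans; [apply H2; assumption|].
    apply Rmult_le_compat_r; [apply pow2_ge_0 | assumption].
Qed.

Lemma qana_ext (rad M : R) F G : (forall z, Cmod z <= rad -> F z = G z) -> qana rad M F -> qana rad M G.
Proof.
  intros H [F' [H1 H2]]. exists F'. split.
  - intros z Hz. rewrite <- H by assumption. apply H1, Hz.
  - intros z w Hz Hw. rewrite <- !H by assumption. apply H2; assumption.
Qed.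

Lemma qana_const (rad : R) (c : C) : qana rad (Cmod c) (fun _ => c).
Proof.
  exists (fun _ => RtoC 0). split.
  - intros z _. split; [lra|]. rewrite Cmod_0. apply Cmod_ge_0.
  - intros z w _ _. replace (c - c - 0 * (w - z))%C with (RtoC 0) by ring.
    rewrite Cmod_0. apply Rmult_le_pos; [apply Cmod_ge_0 | apply pow2_ge_0].
Qed.

Lemma qana_id (rad : R) : rad <= 1 -> qana rad 1 (fun z => z).
Proof.
  intros Hr. exists (fun _ => RtoC 1). split.
  - intros z Hz. rewrite Cmod_1. lra.
  - intros z w _ _. replace (w - z - 1 * (w - z))%C with (RtoC 0) by ring.
    rewrite Cmod_0. pose proof (pow2_ge_0 (Cmod (w - z)%C)). lra.
Qed.

Lemma qana_add (rad M N : R) F G : qana rad M F -> qana rad N G ->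
  qana rad (M + N) (fun z => F z + G z)%C.
Proof.
  intros [F' [F1 F2]] [G' [G1 G2]]. exists (fun z => F' z + G' z)%C. split.
  - intros z Hz. destruct (F1 z Hz), (G1 z Hz).
    split; (eapply Rle_trans; [apply Cmod_triangle | lra]).
  - intros z w Hz Hw.
    replace (F w + G w - (F z + G z) - (F' z + G' z) * (w - z))%C with
      ((F w - F z - F' z * (w - z)) + (G w - G z - G' z * (w - z)))%C by ring.
    eapply Rle_trans; [apply Cmod_triangle|].
    specialize (F2 z w Hz Hw). specialize (G2 z w Hz Hw). nra.
Qed.

(** Points of the disc are at most [2] apart, so the quadratic remainder contributes [2 * M] and the
    derivative [M]. *)
Lemma qana_lip_bound (rad M : R) (F F' : C -> C) (z w : C) : rad <= 1 ->
  Cmod z <= rad -> Cmod w <= rad -> Cmod (F' z) <= M ->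
  Cmod (F w - F z - F' z * (w - z))%C <= M * Cmod (w - z)%C ^ 2 ->
  Cmod (F w - F z)%C <= 3 * M * Cmod (w - z)%C.
Proof.
  intros Hr Hz Hw HF H.
  pose proof (Cmod_triangle (F w - F z - F' z * (w - z))%C (F' z * (w - z))%C) as T.
  replace (F w - F z - F' z * (w - z) + F' z * (w - z))%C with (F w - F z)%C in T by ring.
  rewrite Cmod_mult in T.
  pose proof (Cmod_ge_0 (F' z)). pose proof (Cmod_ge_0 (w - z)%C).
  pose proof (Cmod_sub_le w z).
  assert (M * Cmod (w - z)%C ^ 2 <= M * (2 * Cmod (w - z)%C)).
  { apply Rmult_le_compat_l; nra. }
  assert (Cmod (F' z) * Cmod (w - z)%C <= M * Cmod (w - z)%C) by (apply Rmult_le_compat_r; lra).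
  lra.
Qed.

Lemma qana_lip (rad M : R) F : rad <= 1 -> qana rad M F ->
  forall z w, Cmod z <= rad -> Cmod w <= rad -> Cmod (F w - F z)%C <= 3 * M * Cmod (w - z)%C.
Proof.
  intros Hr [F' [F1 F2]] z w Hz Hw.
  apply qana_lip_bound with rad F'; try assumption; [apply F1, Hz | apply F2; assumption].
Qed.

Lemma Cmod_mult_le (a b : C) (x y : R) : Cmod a <= x -> Cmod b <= y -> Cmod (a * b)%C <= x * y.
Proof.
  intros. rewrite Cmod_mult. apply Rmult_le_compat; try assumption; apply Cmod_ge_0.
Qed.

(** The remainder of the product consists of the remainder of [F] times [G], the derivative of [F]
    times an increment of [G], and [F] times the remainder of [G], with constants [M N], [3 M N] and
    [M N]. *)
Lemma qana_mul (rad M N : R) F G : rad <= 1 -> 0 <= M -> 0 <= N -> qana rad M F -> qana rad N G ->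
  qana rad (5 * M * N) (fun z => F z * G z)%C.
Proof.
  intros Hr HM HN [F' [F1 F2]] HG. pose proof (qana_lip _ _ _ Hr HG) as GL.
  destruct HG as [G' [G1 G2]].
  exists (fun z => F' z * G z + F z * G' z)%C. split.
  - intros z Hz. destruct (F1 z Hz) as [a b], (G1 z Hz) as [c d].
    pose proof (Cmod_mult_le _ _ _ _ a c). pose proof (Cmod_mult_le _ _ _ _ b c).
    pose proof (Cmod_mult_le _ _ _ _ a d).
    assert (0 <= M * N) by (apply Rmult_le_pos; assumption).
    split; [lra|]. eapply Rle_trans; [apply Cmod_triangle | lra].
  - intros z w Hz Hw. destruct (F1 z Hz) as [a b], (G1 w Hw) as [c d].
    replace (F w * G w - F z * G z - (F' z * G z + F z * G' z) * (w - z))%C with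
      ((F w - F z - F' z * (w - z)) * G w + (F' z * (w - z)) * (G w - G z)
       + F z * (G w - G z - G' z * (w - z)))%C by ring.
    pose proof (Cmod_mult_le _ _ _ _ (F2 z w Hz Hw) c).
    pose proof (Cmod_mult_le _ _ _ _ (Cmod_mult_le _ _ _ _ b (Rle_refl (Cmod (w - z)%C))) (GL z w Hz Hw)).
    pose proof (Cmod_mult_le _ _ _ _ a (G2 z w Hz Hw)).
    eapply Rle_trans; [eapply Rle_trans; [apply Cmod_triangle | apply Rplus_le_compat_r, Cmod_triangle]|].
    nra.
Qed.

(** The summand [1] bounds the value, [M] the derivative and the linear part of the remainder, and
    [9 * M ^ 2] the squared increment of the [3 * M]-Lipschitz function [F]. *)
Lemma qana_inv (rad M : R) F : rad <= 1 -> 0 <= M -> qana rad M F ->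
  (forall z, Cmod z <= rad -> 1 <= Cmod (F z)) ->
  qana rad (1 + M + 9 * M ^ 2) (fun z => / F z)%C.
Proof.
  intros Hr HM HF HF1. pose proof (qana_lip _ _ _ Hr HF) as FL.
  destruct HF as [F' [F1 F2]].
  assert (I : forall z, Cmod z <= rad -> F z <> 0 /\ Cmod (/ F z)%C <= 1).
  { intros z Hz. specialize (HF1 z Hz).
    assert (F z <> 0) by (apply Cmod_gt_0; lra). split; [assumption|].
    rewrite Cmod_inv by assumption. rewrite <- Rinv_1. apply Rinv_le_contravar; lra. }
  exists (fun z => - (F' z * (/ F z * / F z)))%C. split.
  - intros z Hz. destruct (I z Hz) as [_ i]. destruct (F1 z Hz) as [_ f'].
    pose proof (Cmod_mult_le _ _ _ _ f' (Cmod_mult_le _ _ _ _ i i)).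
    rewrite Cmod_opp. split; nra.
  - intros z w Hz Hw. destruct (I z Hz) as [nz iz]. destruct (I w Hw) as [nw iw].
    replace (/ F w - / F z - - (F' z * (/ F z * / F z)) * (w - z))%C with
      (- ((F w - F z - F' z * (w - z)) * (/ F z * / F z))
       + ((F w - F z) * (F w - F z)) * ((/ F z * / F z) * / F w))%C by (field; split; assumption).
    eapply Rle_trans; [apply Cmod_triangle|]. rewrite Cmod_opp.
    pose proof (Cmod_mult_le _ _ _ _ (F2 z w Hz Hw) (Cmod_mult_le _ _ _ _ iz iz)).
    pose proof (Cmod_mult_le _ _ _ _ (Cmod_mult_le _ _ _ _ (FL z w Hz Hw) (FL z w Hz Hw))
      (Cmod_mult_le _ _ _ _ (Cmod_mult_le _ _ _ _ iz iz) iw)).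
    pose proof (pow2_ge_0 (Cmod (w - z)%C)). nra.
Qed.

Lemma qana_scal (rad M : R) F (c : C) : qana rad M F -> qana rad (Cmod c * M) (fun z => c * F z)%C.
Proof.
  intros [F' [F1 F2]]. pose proof (Cmod_ge_0 c). exists (fun z => c * F' z)%C. split.
  - intros z Hz. rewrite !Cmod_mult. destruct (F1 z Hz). split; apply Rmult_le_compat_l; assumption.
  - intros z w Hz Hw. replace (c * F w - c * F z - c * F' z * (w - z))%C with
      (c * (F w - F z - F' z * (w - z)))%C by ring.
    rewrite Cmod_mult, Rmult_assoc. apply Rmult_le_compat_l; [assumption | apply F2; assumption].
Qed.

(** * The mean value property *)

Definition expi (t : R) : C := (cos t, sin t).

Lemma Cmod_expi (t : R) : Cmod (expi t) = 1.
Proof.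
  unfold Cmod, expi; simpl fst; simpl snd.
  replace (cos t ^ 2 + sin t ^ 2) with 1 by (pose proof (sin2_cos2 t); unfold Rsqr in *; lra).
  apply sqrt_1.
Qed.

Lemma Rabs_cos_sub (x y : R) : Rabs (cos x - cos y) <= Rabs (x - y).
Proof.
  destruct (MVT_abs cos (fun t => - sin t) y x) as [c [H _]].
  - intros. apply derivable_pt_lim_cos.
  - rewrite H. rewrite Rabs_Ropp. pose proof (Rabs_pos (x - y)).
    assert (Rabs (sin c) <= 1) by (apply Rabs_le; pose proof (SIN_bound c); lra). nra.
Qed.

Lemma Rabs_sin_sub (x y : R) : Rabs (sin x - sin y) <= Rabs (x - y).
Proof.
  destruct (MVT_abs sin cos y x) as [c [H _]].
  - intros. apply derivable_pt_lim_sin.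
  - rewrite H. pose proof (Rabs_pos (x - y)).
    assert (Rabs (cos c) <= 1) by (apply Rabs_le; pose proof (COS_bound c); lra). nra.
Qed.

Lemma expi_lip (x y : R) : Cmod (expi x - expi y)%C <= 2 * Rabs (x - y).
Proof.
  eapply Rle_trans; [apply Cmod_le_Re_Im|].
  pose proof (Rabs_cos_sub x y). pose proof (Rabs_sin_sub x y).
  change (Rabs (cos x - cos y) + Rabs (sin x - sin y) <= 2 * Rabs (x - y)). lra.
Qed.

Lemma expi_deriv (t eps : R) : 0 < eps -> exists d, 0 < d /\ forall k, Rabs k < d ->
  Cmod (expi (t + k) - expi t - k * (Ci * expi t))%C <= eps * Rabs k.
Proof.
  intros He.
  destruct (derivable_pt_lim_cos t (eps / 2)) as [d1 H1]; [lra|].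
  destruct (derivable_pt_lim_sin t (eps / 2)) as [d2 H2]; [lra|].
  exists (Rmin d1 d2). split; [apply Rmin_pos; apply cond_pos|].
  intros k Hk. destruct (Req_dec k 0) as [->|Hk0].
  { rewrite Rplus_0_r, Rabs_R0. replace (expi t - expi t - 0 * (Ci * expi t))%C with (RtoC 0) by ring.
    rewrite Cmod_0. lra. }
  specialize (H1 k Hk0 (Rlt_le_trans _ _ _ Hk (Rmin_l _ _))).
  specialize (H2 k Hk0 (Rlt_le_trans _ _ _ Hk (Rmin_r _ _))).
  assert (K : 0 < Rabs k) by (apply Rabs_pos_lt; assumption).
  assert (A : forall x l, Rabs (x / k - l) < eps / 2 -> Rabs (x - k * l) <= eps / 2 * Rabs k).
  { intros x l H. replace (x - k * l) with ((x / k - l) * k) by (field; assumption).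
    rewrite Rabs_mult. nra. }
  apply A in H1. apply A in H2.
  eapply Rle_trans; [apply Cmod_le_Re_Im|].
  replace (Re _) with (cos (t + k) - cos t - k * - sin t) by (unfold expi; simpl; ring).
  replace (Im _) with (sin (t + k) - sin t - k * cos t) by (unfold expi; simpl; ring).
  lra.
Qed.

Lemma lip_continuous (f : R -> R) (K x : R) :
  (forall y, Rabs (f y - f x) <= K * Rabs (y - x)) -> continuous f x.
Proof.
  intros H. apply continuity_pt_filterlim. intros eps He.
  assert (HK : 0 <= K).
  { specialize (H (x + 1)). replace (x + 1 - x) with 1 in H by ring.
    rewrite Rabs_R1 in H. pose proof (Rabs_pos (f (x + 1) - f x)). lra. }
  exists (eps / (K + 1)). split.
  - apply Rdiv_lt_0_compat; lra.
  - intros y [_ Hy]. simpl in *. unfold Rdist in *.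
    eapply Rle_lt_trans; [apply H|].
    apply Rle_lt_trans with (K * (eps / (K + 1))).
    + apply Rmult_le_compat_l; lra.
    + apply Rmult_lt_reg_r with (K + 1); [lra|]. unfold Rdiv.
      replace (K * (eps * / (K + 1)) * (K + 1)) with (K * eps) by (field; lra). nra.
Qed.

Lemma lip_ex_RInt (f : R -> R) (K a b : R) :
  (forall x y, Rabs (f y - f x) <= K * Rabs (y - x)) -> ex_RInt f a b.
Proof.
  intros H. apply (ex_RInt_continuous (V := R_CompleteNormedModule)). intros z _. apply lip_continuous with K. auto.
Qed.

Lemma RInt_minus_R (f g : R -> R) (a b : R) : ex_RInt f a b -> ex_RInt g a b ->
  ex_RInt (fun t => f t - g t) a b /\ RInt (fun t => f t - g t) a b = RInt f a b - RInt g a b.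
Proof.
  intros Hf Hg. split.
  - exact (ex_RInt_minus (V := R_NormedModule) f g a b Hf Hg).
  - exact (RInt_minus (V := R_CompleteNormedModule) f g a b Hf Hg).
Qed.

Lemma RInt_plus_R (f g : R -> R) (a b : R) : ex_RInt f a b -> ex_RInt g a b ->
  ex_RInt (fun t => f t + g t) a b /\ RInt (fun t => f t + g t) a b = RInt f a b + RInt g a b.
Proof.
  intros Hf Hg. split.
  - exact (ex_RInt_plus (V := R_NormedModule) f g a b Hf Hg).
  - exact (RInt_plus (V := R_CompleteNormedModule) f g a b Hf Hg).
Qed.

Lemma RInt_scal_R (f : R -> R) (k a b : R) : ex_RInt f a b ->
  ex_RInt (fun t => k * f t) a b /\ RInt (fun t => k * f t) a b = k * RInt f a b.
Proof.
  intros Hf. split.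
  - exact (ex_RInt_scal (V := R_NormedModule) f a b k Hf).
  - exact (RInt_scal (V := R_CompleteNormedModule) f a b k Hf).
Qed.

Lemma RInt_const_R (k a b : R) :
  ex_RInt (fun _ => k) a b /\ RInt (fun _ => k) a b = (b - a) * k.
Proof.
  split; [apply ex_RInt_const | exact (RInt_const (V := R_CompleteNormedModule) a b k)].
Qed.

(** Cutting [[a, b]] into [n] equal steps bounds the total increment by [K * (b - a) ^ 2 / n]. It is
    applied to circular means, whose increments are quadratically small. *)
Lemma quadratic_const (phi : R -> R) (K a b : R) : a <= b ->
  (forall r s, a <= r <= b -> a <= s <= b -> Rabs (phi s - phi r) <= K * (s - r) ^ 2) ->
  phi b = phi a.
Proof.
  intros Hab H.
  assert (K1 : 0 <= K * (b - a) ^ 2).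
  { eapply Rle_trans; [apply Rabs_pos | apply H; lra]. }
  assert (S : forall n : nat, Rabs (phi b - phi a) <= K * (b - a) ^ 2 * / INR (S n)).
  { intros n. set (N := INR (S n)). assert (HN : 0 < N) by (apply lt_0_INR; lia).
    assert (P : forall k : nat, (k <= S n)%nat ->
      Rabs (phi (a + INR k * ((b - a) / N)) - phi a) <= INR k * (K * ((b - a) / N) ^ 2)).
    { assert (D : 0 <= (b - a) / N) by (apply Rdiv_le_0_compat; lra).
      assert (E : N * ((b - a) / N) = b - a) by (field; lra).
      induction k as [|k IH]; intros Hk.
      - simpl INR. replace (a + 0 * ((b - a) / N)) with a by ring.
        rewrite Rminus_diag, Rabs_R0. lra.
      - specialize (IH ltac:(lia)).
        assert (Hk' : INR (S k) <= N) by (apply le_INR; assumption).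
        rewrite S_INR in *. pose proof (pos_INR k).
        specialize (H (a + INR k * ((b - a) / N)) (a + (INR k + 1) * ((b - a) / N))).
        replace (phi (a + (INR k + 1) * ((b - a) / N)) - phi a) with
          ((phi (a + (INR k + 1) * ((b - a) / N)) - phi (a + INR k * ((b - a) / N)))
           + (phi (a + INR k * ((b - a) / N)) - phi a)) by ring.
        eapply Rle_trans; [apply Rabs_triang|].
        replace (a + (INR k + 1) * ((b - a) / N) - (a + INR k * ((b - a) / N))) with ((b - a) / N)
          in H by ring.
        assert (Rabs (phi (a + (INR k + 1) * ((b - a) / N)) - phi (a + INR k * ((b - a) / N)))
          <= K * ((b - a) / N) ^ 2) by (apply H; split; nra). lra. }
    specialize (P (S n) (Nat.le_refl _)). fold N in P.
    replace (a + N * ((b - a) / N)) with b in P by (field; lra).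
    replace (N * (K * ((b - a) / N) ^ 2)) with (K * (b - a) ^ 2 * / N) in P by (field; lra).
    exact P. }
  apply cond_eq. intros eps He.
  destruct (archimed_cor1 (eps / (K * (b - a) ^ 2 + 1))) as [n [Hn1 Hn2]].
  { apply Rdiv_lt_0_compat; lra. }
  destruct n as [|n]; [lia|]. eapply Rle_lt_trans; [apply (S n)|].
  assert (0 < / INR (Datatypes.S n)) by (apply Rinv_0_lt_compat, lt_0_INR; lia).
  apply Rle_lt_trans with ((K * (b - a) ^ 2 + 1) * / INR (Datatypes.S n)); [nra|].
  apply Rmult_lt_compat_l with (r := K * (b - a) ^ 2 + 1) in Hn1; [|lra].
  replace ((K * (b - a) ^ 2 + 1) * (eps / (K * (b - a) ^ 2 + 1))) with eps in Hn1 by (field; lra).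
  exact Hn1.
Qed.

Lemma is_derive_of_bound (f : R -> R) (t l : R) :
  (forall eps, 0 < eps -> exists d, 0 < d /\ forall k, Rabs k < d ->
     Rabs (f (t + k) - f t - k * l) <= eps * Rabs k) -> is_derive f t l.
Proof.
  intros H. apply is_derive_Reals. intros eps He.
  destruct (H (eps / 2)) as [d [Hd Hk]]; [lra|].
  exists (mkposreal d Hd). intros k Hk0 Hkd. simpl in Hkd. specialize (Hk k Hkd).
  assert (0 < Rabs k) by (apply Rabs_pos_lt; assumption).
  replace ((f (t + k) - f t) / k - l) with ((f (t + k) - f t - k * l) / k) by (field; assumption).
  unfold Rdiv. rewrite Rabs_mult, Rabs_inv.
  apply Rmult_lt_reg_r with (Rabs k); [assumption|].
  rewrite Rmult_assoc, Rinv_l by lra. nra.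
Qed.

Section MeanValue.
Variables (H H' : C -> C) (M : R).
Hypothesis HB : forall z, Cmod z <= 1 -> Cmod (H z) <= M /\ Cmod (H' z) <= M.
Hypothesis HQ : forall z w, Cmod z <= 1 -> Cmod w <= 1 ->
  Cmod (H w - H z - H' z * (w - z))%C <= M * Cmod (w - z)%C ^ 2.

Let M_pos : 0 <= M.
Proof.
  assert (Cmod 0 <= 1) by (rewrite Cmod_0; lra).
  eapply Rle_trans; [apply Cmod_ge_0 | apply (HB 0); assumption].
Qed.

Let HL : forall z w, Cmod z <= 1 -> Cmod w <= 1 -> Cmod (H w - H z)%C <= 3 * M * Cmod (w - z)%C.
Proof.
  intros z w Hz Hw. apply qana_lip_bound with 1 H'; try assumption; [lra | apply HB, Hz | apply HQ; assumption].
Qed.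

(** Adding the quadratic estimates at [z] and at [w] cancels the values of [H] and leaves
    [(H' w - H' z) * (w - z)]. This makes the derivative integrable on circles. *)
Let HL' : forall z w, Cmod z <= 1 -> Cmod w <= 1 -> Cmod (H' w - H' z)%C <= 2 * M * Cmod (w - z)%C.
Proof.
  intros z w Hz Hw. destruct (Ceq_dec w z) as [->|Hne].
  { replace (H' z - H' z)%C with (RtoC 0) by ring. rewrite Cmod_0.
    pose proof (Cmod_ge_0 (z - z)%C). nra. }
  assert (Hp : 0 < Cmod (w - z)%C) by (apply Cmod_gt_0, Cminus_eq_contra, Hne).
  pose proof (HQ z w Hz Hw) as A1. pose proof (HQ w z Hw Hz) as A2.
  pose proof (Cmod_triangle (H w - H z - H' z * (w - z))%C (H z - H w - H' w * (z - w))%C) as T.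
  replace (H w - H z - H' z * (w - z) + (H z - H w - H' w * (z - w)))%C with
    ((H' w - H' z) * (w - z))%C in T by ring.
  rewrite Cmod_mult in T. rewrite (Cmod_sub_sym z w) in A2.
  apply Rmult_le_reg_r with (Cmod (w - z)%C); [assumption|]. lra.
Qed.

Let disc (r t : R) : 0 <= r <= 1 -> Cmod (r * expi t)%C <= 1.
Proof. intros. rewrite Cmod_radial by (try apply Cmod_expi; lra). lra. Qed.

Let circle_lip (F : C -> C) (K : R) :
  0 <= K -> (forall z w, Cmod z <= 1 -> Cmod w <= 1 -> Cmod (F w - F z)%C <= K * Cmod (w - z)%C) ->
  forall r, 0 <= r <= 1 -> forall x y, Cmod (F (r * expi y) - F (r * expi x))%C <= 2 * K * Rabs (y - x).
Proof.
  intros HK HF r Hr x y. eapply Rle_trans; [apply HF; apply disc; assumption|].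
  replace (r * expi y - r * expi x)%C with (r * (expi y - expi x))%C by ring.
  rewrite Cmod_mult, Cmod_R, Rabs_pos_eq by lra.
  pose proof (expi_lip y x). pose proof (Cmod_ge_0 (expi y - expi x)%C).
  assert (r * Cmod (expi y - expi x)%C <= 1 * (2 * Rabs (y - x))) by (apply Rmult_le_compat; lra).
  nra.
Qed.

Let dH_lip (r : R) : 0 <= r <= 1 -> forall x y,
  Rabs (Re (H' (r * expi y) * expi y)%C - Re (H' (r * expi x) * expi x)%C) <= 6 * M * Rabs (y - x).
Proof.
  intros Hr x y. rewrite <- re_minus. eapply Rle_trans; [apply re_le_Cmod|].
  replace (H' (r * expi y) * expi y - H' (r * expi x) * expi x)%C with
    ((H' (r * expi y) - H' (r * expi x)) * expi y + H' (r * expi x) * (expi y - expi x))%C by ring.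
  eapply Rle_trans; [apply Cmod_triangle|]. rewrite !Cmod_mult, Cmod_expi.
  pose proof (circle_lip H' (2 * M) ltac:(lra) HL' r Hr x y).
  destruct (HB (r * expi x)%C (disc r x Hr)) as [_ b].
  pose proof (expi_lip y x). pose proof (Cmod_ge_0 (expi y - expi x)%C).
  pose proof (Cmod_ge_0 (H' (r * expi x))).
  assert (Cmod (H' (r * expi x)) * Cmod (expi y - expi x)%C <= M * (2 * Rabs (y - x)))
    by (apply Rmult_le_compat; lra).
  lra.
Qed.

Let H_lip (r : R) : 0 <= r <= 1 -> forall x y,
  Rabs (Re (H (r * expi y)%C) - Re (H (r * expi x)%C)) <= 6 * M * Rabs (y - x).
Proof.
  intros Hr x y. rewrite <- re_minus. eapply Rle_trans; [apply re_le_Cmod|].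
  pose proof (circle_lip H (3 * M) ltac:(lra) HL r Hr x y). lra.
Qed.

(** The integrand times [r] is the derivative in [t] of [Im (H (r * expi t))], because
    [Im (i u) = Re u]; over a full period it integrates to zero. The factor [r] is cancelled at the
    end, whence [0 < r]. *)
Let RInt_dH (r : R) : 0 < r <= 1 -> RInt (fun t => Re (H' (r * expi t) * expi t)%C) 0 (2 * PI) = 0.
Proof.
  intros Hr.
  assert (I : is_RInt (fun t => r * Re (H' (r * expi t) * expi t)%C) 0 (2 * PI)
                (minus (Im (H (r * expi (2 * PI))%C)) (Im (H (r * expi 0)%C)))).
  { apply (is_RInt_derive (V := R_CompleteNormedModule) (fun t => Im (H (r * expi t)%C))
      (fun t => r * Re (H' (r * expi t) * expi t)%C)).
    - intros t _. apply is_derive_of_bound. intros eps He.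
      destruct (expi_deriv t (eps / (2 * (M + 1)))) as [d [Hd Ht]].
      { apply Rdiv_lt_0_compat; lra. }
      exists (Rmin d (eps / (8 * (M + 1)))). split.
      { apply Rmin_pos; [assumption | apply Rdiv_lt_0_compat; lra]. }
      intros k Hk. specialize (Ht k (Rlt_le_trans _ _ _ Hk (Rmin_l _ _))).
      pose proof (Rlt_le_trans _ _ _ Hk (Rmin_r _ _)) as Hk2.
      assert (G : forall p q u e : C, Im p - Im q - k * (r * Re (u * e)%C)
        = Im (p - q - u * (r * (k * (Ci * e))))%C) by (intros [] [] [] []; simpl; ring).
      rewrite G.
      eapply Rle_trans; [apply im_le_Cmod|].
      (* The first part is the quadratic remainder of [H], the second the error of linearizing
         [expi]; each receives half of [eps]. *)
      replace (H (r * expi (t + k)) - H (r * expi t) - H' (r * expi t) * (r * (k * (Ci * expi t))))%C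
        with ((H (r * expi (t + k)) - H (r * expi t)
                 - H' (r * expi t) * (r * expi (t + k) - r * expi t))
              + H' (r * expi t) * (r * (expi (t + k) - expi t - k * (Ci * expi t))))%C by ring.
      eapply Rle_trans; [apply Cmod_triangle|].
      pose proof (HQ (r * expi t)%C (r * expi (t + k))%C (disc r _ ltac:(lra)) (disc r _ ltac:(lra))) as Q.
      assert (L : Cmod (r * expi (t + k) - r * expi t)%C <= 2 * Rabs k).
      { replace (r * expi (t + k) - r * expi t)%C with (r * (expi (t + k) - expi t))%C by ring.
        rewrite Cmod_mult, Cmod_R, Rabs_pos_eq by lra.
        pose proof (expi_lip (t + k) t) as L. replace (t + k - t) with k in L by ring.
        pose proof (Cmod_ge_0 (expi (t + k) - expi t)%C). nra. }
      pose proof (Cmod_ge_0 (r * expi (t + k) - r * expi t)%C) as L0.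
      assert (Q1 : M * Cmod (r * expi (t + k) - r * expi t)%C ^ 2 <= M * (4 * Rabs k * Rabs k)).
      { apply Rmult_le_compat_l; [assumption | nra]. }
      rewrite Cmod_mult. destruct (HB (r * expi t)%C (disc r t ltac:(lra))) as [_ b].
      assert (R1 : Cmod (r * (expi (t + k) - expi t - k * (Ci * expi t)))%C
                   <= eps / (2 * (M + 1)) * Rabs k).
      { rewrite Cmod_mult, Cmod_R, Rabs_pos_eq by lra.
        pose proof (Cmod_ge_0 (expi (t + k) - expi t - k * (Ci * expi t))%C). nra. }
      assert (R2 : Cmod (H' (r * expi t)) * Cmod (r * (expi (t + k) - expi t - k * (Ci * expi t)))%C
                   <= M * (eps / (2 * (M + 1)) * Rabs k)).
      { apply Rmult_le_compat; try apply Cmod_ge_0; assumption. }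
      pose proof (Rabs_pos k).
      assert (E1 : M * (4 * Rabs k * Rabs k) <= (eps / 2) * Rabs k).
      { assert (M * 4 * Rabs k <= eps / 2).
        { apply Rle_trans with ((M + 1) * 4 * (eps / (8 * (M + 1)))).
          - apply Rmult_le_compat; lra.
          - right. field. lra. }
        nra. }
      assert (E2 : M * (eps / (2 * (M + 1)) * Rabs k) <= (eps / 2) * Rabs k).
      { rewrite <- Rmult_assoc. apply Rmult_le_compat_r; [assumption|].
        assert (0 < eps / (2 * (M + 1))) by (apply Rdiv_lt_0_compat; lra).
        apply Rle_trans with ((M + 1) * (eps / (2 * (M + 1)))); [nra|]. right. field. lra. }
      lra.
    - intros t _. apply lip_continuous with (6 * M). intros y.
      rewrite <- Rmult_minus_distr_l, Rabs_mult, (Rabs_pos_eq r) by lra.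
      pose proof (dH_lip r ltac:(lra) t y).
      pose proof (Rabs_pos (Re (H' (r * expi y) * expi y)%C - Re (H' (r * expi t) * expi t)%C)). nra. }
  assert (E : expi (2 * PI) = expi 0).
  { unfold expi. rewrite cos_2PI, sin_2PI, cos_0, sin_0. reflexivity. }
  rewrite E, minus_eq_zero in I.
  assert (X : ex_RInt (fun t => Re (H' (r * expi t) * expi t)%C) 0 (2 * PI)).
  { apply lip_ex_RInt with (6 * M). apply dH_lip. lra. }
  pose proof (is_RInt_unique _ _ _ _ I) as U.
  destruct (RInt_scal_R _ r _ _ X) as [_ U'].
  pose proof (eq_trans (eq_sym U') U) as U0.
  apply Rmult_integral in U0. destruct U0; [lra | assumption].
Qed.

Let phi (r : R) : R := RInt (fun t => Re (H (r * expi t)%C)) 0 (2 * PI).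

Let phi_ex (r : R) : 0 <= r <= 1 -> ex_RInt (fun t => Re (H (r * expi t)%C)) 0 (2 * PI).
Proof. intros. apply lip_ex_RInt with (6 * M). apply H_lip. assumption. Qed.

(** The first-order term integrates to zero by [RInt_dH], which leaves the pointwise remainder
    [M * (s - r) ^ 2]. *)
Let phi_quad (r s : R) : 0 < r <= 1 -> 0 < s <= 1 -> Rabs (phi s - phi r) <= 2 * PI * M * (s - r) ^ 2.
Proof.
  intros Hr Hs. pose proof PI_RGT_0.
  assert (X : ex_RInt (fun t => Re (H' (r * expi t) * expi t)%C) 0 (2 * PI)).
  { apply lip_ex_RInt with (6 * M). apply dH_lip. lra. }
  pose proof (phi_ex r ltac:(lra)) as Xr. pose proof (phi_ex s ltac:(lra)) as Xs.
  set (g := fun t => Re (H (s * expi t)%C) - Re (H (r * expi t)%C)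
                       - (s - r) * Re (H' (r * expi t) * expi t)%C).
  destruct (RInt_scal_R _ (s - r) _ _ X) as [X1 E1].
  destruct (RInt_minus_R _ _ _ _ Xs Xr) as [X2 E2].
  destruct (RInt_minus_R _ _ _ _ X2 X1) as [Xg E3].
  assert (E : phi s - phi r = RInt g 0 (2 * PI)).
  { unfold g. rewrite E3, E2, E1, RInt_dH by assumption. unfold phi. ring. }
  rewrite E. eapply Rle_trans; [apply abs_RInt_le_const with (M := M * (s - r) ^ 2)|].
  - lra.
  - assumption.
  - intros t _. unfold g.
    assert (G : forall p q u e : C, Re p - Re q - (s - r) * Re (u * e)%C
      = Re (p - q - u * (s * e - r * e))%C) by (intros [] [] [] []; simpl; ring).
    rewrite G.
    eapply Rle_trans; [apply re_le_Cmod|].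
    eapply Rle_trans; [apply HQ; apply disc; lra|].
    replace (s * expi t - r * expi t)%C with (RtoC (s - r) * expi t)%C by (rewrite RtoC_minus; ring).
    rewrite Cmod_mult, Cmod_expi, Cmod_R, Rmult_1_r, pow2_abs. lra.
  - right. ring.
Qed.

(** Constancy of the means is available for positive radii; this estimate reaches the centre as [r]
    tends to [0]. *)
Let phi_0 (r : R) : 0 <= r <= 1 -> Rabs (phi r - 2 * PI * Re (H 0)) <= 6 * PI * M * r.
Proof.
  intros Hr. pose proof PI_RGT_0.
  set (g := fun t => Re (H (r * expi t)%C) - Re (H 0)).
  destruct (RInt_const_R (Re (H 0)) 0 (2 * PI)) as [Xc E1].
  destruct (RInt_minus_R _ _ _ _ (phi_ex r Hr) Xc) as [Xg E2].
  assert (E : phi r - 2 * PI * Re (H 0) = RInt g 0 (2 * PI)).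
  { unfold g. rewrite E2, E1. unfold phi. ring. }
  rewrite E. eapply Rle_trans; [apply abs_RInt_le_const with (M := 3 * M * r)|].
  - lra.
  - exact Xg.
  - intros t _. unfold g.
    change (Rabs (Re (H (r * expi t) - H 0)%C) <= 3 * M * r).
    eapply Rle_trans; [apply re_le_Cmod|].
    eapply Rle_trans; [apply HL; [rewrite Cmod_0; lra | apply disc; assumption]|].
    replace (r * expi t - 0)%C with (r * expi t)%C by ring.
    rewrite Cmod_radial by (try apply Cmod_expi; lra). lra.
  - right. ring.
Qed.

Lemma mean_value_sect : RInt (fun t => Re (H (expi t))) 0 (2 * PI) = 2 * PI * Re (H 0).
Proof.
  pose proof PI_RGT_0.
  assert (E : RInt (fun t => Re (H (expi t))) 0 (2 * PI) = phi 1).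
  { unfold phi. apply RInt_ext. intros. rewrite Cmult_1_l. reflexivity. }
  rewrite E. apply cond_eq. intros eps He.
  set (r := Rmin 1 (eps / (2 * (6 * PI * M + 1)))).
  assert (K : 0 <= 6 * PI * M) by nra.
  assert (Hr0 : 0 < r).
  { apply Rmin_pos; [lra|]. apply Rdiv_lt_0_compat; lra. }
  assert (Hr1 : r <= 1) by apply Rmin_l.
  assert (Hr2 : r <= eps / (2 * (6 * PI * M + 1))) by apply Rmin_r.
  rewrite (quadratic_const phi (2 * PI * M) r 1); [|assumption|].
  - eapply Rle_lt_trans; [apply phi_0; lra|].
    apply Rle_lt_trans with ((6 * PI * M + 1) * (eps / (2 * (6 * PI * M + 1)))).
    + apply Rmult_le_compat; lra.
    + replace ((6 * PI * M + 1) * (eps / (2 * (6 * PI * M + 1)))) with (eps / 2) by (field; lra). lra.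
  - intros x y Hx Hy. apply phi_quad; lra.
Qed.

End MeanValue.

Lemma mean_value (H : C -> C) (M : R) : qana 1 M H ->
  RInt (fun t => Re (H (expi t))) 0 (2 * PI) = 2 * PI * Re (H 0).
Proof. intros [H' [H1 H2]]. exact (mean_value_sect H H' M H1 H2). Qed.

Lemma qana_expi_lip (H : C -> C) (M : R) : qana 1 M H -> forall x y,
  Rabs (Re (H (expi y)) - Re (H (expi x))) <= 6 * M * Rabs (y - x).
Proof.
  intros HQ x y. rewrite <- re_minus. eapply Rle_trans; [apply re_le_Cmod|].
  eapply Rle_trans; [apply (qana_lip 1 M H (Rle_refl 1) HQ); rewrite Cmod_expi; lra|].
  assert (0 <= M).
  { destruct HQ as [F' [F1 _]]. eapply Rle_trans; [apply Cmod_ge_0 | apply (F1 (expi x))].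
    rewrite Cmod_expi; lra. }
  pose proof (expi_lip y x). nra.
Qed.

(** For uses where the constant is immaterial. With [rad = 1] the bounds hold up to and including
    the circle. *)
Definition analytic (rad : R) (F : C -> C) : Prop := exists M, 0 <= M /\ qana rad M F.

Lemma analytic_const (rad : R) (c : C) : analytic rad (fun _ => c).
Proof. exists (Cmod c). split; [apply Cmod_ge_0 | apply qana_const]. Qed.

Lemma analytic_id (rad : R) : rad <= 1 -> analytic rad (fun z => z).
Proof. exists 1. split; [lra | apply qana_id; assumption]. Qed.

Lemma analytic_add (rad : R) F G : analytic rad F -> analytic rad G -> analytic rad (fun z => F z + G z)%C.
Proof. intros [M [HM HF]] [N [HN HG]]. exists (M + N). split; [lra | apply qana_add; assumption]. Qed.

Lemma analytic_mul (rad : R) F G : rad <= 1 -> analytic rad F -> analytic rad G ->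
  analytic rad (fun z => F z * G z)%C.
Proof.
  intros Hr [M [HM HF]] [N [HN HG]]. exists (5 * M * N). split; [|apply qana_mul; assumption].
  repeat apply Rmult_le_pos; lra.
Qed.

(** Scaling by [1 / m] reduces to modulus at least [1], the case of [qana_inv]. *)
Lemma analytic_inv (rad m : R) F : rad <= 1 -> 0 < m -> analytic rad F ->
  (forall z, Cmod z <= rad -> m <= Cmod (F z)) -> analytic rad (fun z => / F z)%C.
Proof.
  intros Hr Hm [M [HM HF]] HFm.
  assert (Hi : 0 < / m) by (apply Rinv_0_lt_compat; assumption).
  assert (Em : Cmod (/ m)%C = / m).
  { rewrite <- RtoC_inv by lra. rewrite Cmod_R, Rabs_pos_eq; lra. }
  pose proof (qana_scal _ _ _ (/ m)%C HF) as H1. rewrite Em in H1.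
  assert (HM1 : 0 <= / m * M) by (apply Rmult_le_pos; lra).
  apply qana_inv in H1; try assumption.
  - apply (qana_scal _ _ _ (/ m)%C) in H1. rewrite Em in H1.
    eexists. split; [|eapply qana_ext; [|exact H1]].
    + apply Rmult_le_pos; nra.
    + intros z Hz. simpl. specialize (HFm z Hz).
      assert (F z <> 0) by (apply Cmod_gt_0; lra). field. split; [assumption|].
      intros E. apply RtoC_inj in E. lra.
  - intros z Hz. rewrite Cmod_mult, Em. specialize (HFm z Hz).
    rewrite <- (Rinv_l m) by lra. apply Rmult_le_compat_l; lra.
Qed.

(** * The Poisson formula *)

Definition poisson (a z : C) : R := (1 - Cmod a ^ 2) / Cmod (z - a)%C ^ 2.

Lemma Cmod_one_sub_conj_ge (a z : C) : Cmod z <= 1 -> 1 - Cmod a <= Cmod (1 - Cconj a * z)%C.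
Proof.
  intros Hz. pose proof (Cmod_rev_triangle 1 (Cconj a * z)%C) as H.
  rewrite Cmod_1, Cmod_mult, Cmod_conj in H. pose proof (Cmod_ge_0 a). nra.
Qed.

(** On the circle [conj z * z = 1] turns [|z - a|^2 * z] into [(z - a) * (1 - conj a * z)]. The
    factor [z - a] will cancel against that of [F z - F a], and the factor [z] makes the product
    vanish at the origin. *)
Lemma poisson_eq_factor (a z : C) : Cmod z = 1 -> Cmod a < 1 ->
  RtoC (poisson a z) = ((1 - Cmod a ^ 2) * z * / ((z - a) * (1 - Cconj a * z)))%C.
Proof.
  intros Hz Ha.
  pose proof (Cmod_one_sub_conj_ge a z ltac:(lra)).
  pose proof (Cmod_rev_triangle z a).
  assert (n1 : (z - a)%C <> 0) by (apply Cmod_gt_0; lra).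
  assert (n2 : (1 - Cconj a * z)%C <> 0) by (apply Cmod_gt_0; lra).
  assert (n3 : z <> 0) by (apply Cmod_gt_0; lra).
  assert (E : ((z - a) * (1 - Cconj a * z) = RtoC (Cmod (z - a)%C ^ 2) * z)%C).
  { rewrite Cmod2_conj, Cminus_conj.
    transitivity ((z - a) * (Cconj z * z - Cconj a * z))%C; [|ring].
    rewrite conj_mul_self by assumption. reflexivity. }
  rewrite E. unfold poisson.
  assert (n4 : Cmod (z - a)%C ^ 2 <> 0) by (apply pow_nonzero; lra).
  rewrite RtoC_div, RtoC_minus, RtoC_pow by assumption.
  field. split; [assumption|]. intros E'. apply RtoC_inj in E'. contradiction.
Qed.

(** The kernel is [1] plus the real part of a function analytic on the closed disc and zero at the
    origin, so its mean is [1]. *)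
Lemma poisson_eq_Re (a z : C) : Cmod z = 1 -> Cmod a < 1 ->
  poisson a z = 1 + Re (2 * Cconj a * z * / (1 - Cconj a * z))%C.
Proof.
  intros Hz Ha.
  pose proof (Cmod_one_sub_conj_ge a z ltac:(lra)).
  assert (n2 : (1 - Cconj a * z)%C <> 0) by (apply Cmod_gt_0; lra).
  set (u := (Cconj a * z)%C) in *.
  assert (Hu : Cmod u = Cmod a) by (unfold u; rewrite Cmod_mult, Cmod_conj, Hz; ring).
  assert (E : Cmod (z - a)%C = Cmod (1 - u)%C).
  { replace (z - a)%C with (z * Cconj (1 - u))%C.
    - rewrite Cmod_mult, Cmod_conj, Hz. ring.
    - unfold u. rewrite Cminus_conj, Cmult_conj, Cconj_conj.
      replace (Cconj (RtoC 1)) with (RtoC 1) by (unfold Cconj, RtoC; simpl; f_equal; ring).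
      transitivity (z - a * (Cconj z * z))%C; [ring|]. rewrite conj_mul_self by assumption. ring. }
  unfold poisson. rewrite E, <- Hu.
  replace (2 * Cconj a * z * / (1 - u))%C with (2 * u * / (1 - u))%C by (unfold u; ring).
  assert (D : 0 < Cmod (1 - u)%C ^ 2) by (apply pow_lt; lra).
  rewrite !Cmod2_alt in *. destruct u as [x y]. simpl in *. field.
  apply Rgt_not_eq. lra.
Qed.

(** With [F = F a + (F - F a)], the kernel is expanded by [poisson_eq_Re] against the constant and
    by [poisson_eq_factor] against the difference. Both analytic functions that arise vanish at [0],
    so the mean value property leaves only [Re (F a)]. *)
Lemma poisson_formula (F D : C -> C) (a : C) : Cmod a < 1 -> analytic 1 D ->
  (forall z, Cmod z <= 1 -> (F z - F a = (z - a) * D z)%C) ->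
  ex_RInt (fun t => Re (F (expi t)) * poisson a (expi t)) 0 (2 * PI) /\
  RInt (fun t => Re (F (expi t)) * poisson a (expi t)) 0 (2 * PI) = 2 * PI * Re (F a).
Proof.
  intros Ha HD HF.
  assert (I : analytic 1 (fun z => / (1 - Cconj a * z))%C).
  { apply analytic_inv with (1 - Cmod a); try lra.
    - apply analytic_add; [apply analytic_const|].
      destruct (analytic_mul 1 (fun _ => (- Cconj a)%C) (fun z => z)) as [M [HM HQ]];
        [lra | apply analytic_const | apply analytic_id; lra |].
      exists M. split; [assumption|]. eapply qana_ext; [|exact HQ]. intros; simpl; ring.
    - intros z Hz. apply Cmod_one_sub_conj_ge, Hz. }
  assert (HK : analytic 1 (fun z => 2 * Cconj a * z * / (1 - Cconj a * z))%C).
  { apply analytic_mul; [lra | | exact I].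
    apply analytic_mul; [lra | apply analytic_const | apply analytic_id; lra]. }
  assert (HH : analytic 1 (fun z => (1 - Cmod a ^ 2) * z * (D z * / (1 - Cconj a * z)))%C).
  { apply analytic_mul; [lra | |].
    - apply analytic_mul; [lra | apply analytic_const | apply analytic_id; lra].
    - apply analytic_mul; [lra | exact HD | exact I]. }
  destruct HK as [M [HM HK]]. destruct HH as [N [HN HH]].
  pose proof (mean_value _ _ HK) as VK. pose proof (mean_value _ _ HH) as VH.
  pose proof (lip_ex_RInt _ _ 0 (2 * PI) (qana_expi_lip _ _ HK)) as XK.
  pose proof (lip_ex_RInt _ _ 0 (2 * PI) (qana_expi_lip _ _ HH)) as XH.
  cbv beta in VK, VH.
  destruct (RInt_const_R 1 0 (2 * PI)) as [X1 V1].
  destruct (RInt_plus_R _ _ _ _ X1 XK) as [X2 V2].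
  destruct (RInt_scal_R _ (Re (F a)) _ _ X2) as [X3 V3].
  destruct (RInt_plus_R _ _ _ _ X3 XH) as [X4 V4].
  assert (E : forall t, Re (F a) * (1 + Re (2 * Cconj a * expi t * / (1 - Cconj a * expi t))%C)
    + Re ((1 - Cmod a ^ 2) * expi t * (D (expi t) * / (1 - Cconj a * expi t)))%C
    = Re (F (expi t)) * poisson a (expi t)).
  { intros t. pose proof (Cmod_expi t) as Ht.
    rewrite <- poisson_eq_Re by assumption.
    assert (G : ((1 - Cmod a ^ 2) * expi t * (D (expi t) * / (1 - Cconj a * expi t)))%C
      = (RtoC (poisson a (expi t)) * (F (expi t) - F a))%C).
    { rewrite HF by lra. rewrite poisson_eq_factor by assumption. field.
      pose proof (Cmod_one_sub_conj_ge a (expi t) ltac:(lra)).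
      pose proof (Cmod_rev_triangle (expi t) a).
      split; apply Cmod_gt_0; lra. }
    rewrite G, re_scal_l, re_minus. ring. }
  split.
  - eapply ex_RInt_ext; [|exact X4]. intros t _. apply E.
  - rewrite <- (RInt_ext _ _ 0 (2 * PI) (fun t _ => E t)).
    etransitivity; [exact V4|]. rewrite V3, V2, V1, VK, VH.
    rewrite !Cmult_0_r, !Cmult_0_l. simpl. ring.
Qed.

(** * Potentials of finite families of arcs *)

Fixpoint lsum {T : Type} (f : T -> R) (L : list T) : R :=
  match L with nil => 0 | b :: L => f b + lsum f L end.

Definition mass (V : list (C * R)) : R := lsum snd V.

(* The pair [(c, rho)] stands for the arc of points of the circle at distance at most [rho] from [c]. *)
Definition arc (b : C * R) : Prop := Cmod (fst b) = 1 /\ 0 < snd b.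

Definition covers (V : list (C * R)) (z : C) : Prop := List.Exists (fun b => Cmod (z - fst b)%C <= snd b) V.

(** For an arc the pole [(1 + rho) * c] lies at distance [rho] outside the circle: the kernel is of
    order [1] on the arc and at most [rho / |z - c|] elsewhere. *)
Definition kern (b : C * R) (z : C) : C := (snd b * / (1 + snd b - Cconj (fst b) * z))%C.

Fixpoint pot (V : list (C * R)) (z : C) : C :=
  match V with nil => RtoC 0 | b :: V => (kern b z + pot V z)%C end.

Lemma kern_den_Re (b : C * R) (z : C) : arc b ->
  1 - Cmod z + snd b <= Re (1 + snd b - Cconj (fst b) * z)%C.
Proof.
  intros [Hc _]. pose proof (Re_one_sub_conj (fst b) z Hc) as H.
  rewrite !re_minus, re_plus, !re_RtoC in *. lra.
Qed.

(** The bounds serve near the arc, in the interior and far from the arc. For the third,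
    [1 - conj c * z] has nonnegative real part and modulus [|z - c|], and adding [rho] can only
    enlarge its modulus. *)
Lemma kern_den_Cmod (b : C * R) (z : C) : arc b -> Cmod z <= 1 ->
  snd b <= Cmod (1 + snd b - Cconj (fst b) * z)%C /\
  1 - Cmod z <= Cmod (1 + snd b - Cconj (fst b) * z)%C /\
  Cmod (z - fst b)%C <= Cmod (1 + snd b - Cconj (fst b) * z)%C.
Proof.
  intros Hb Hz. pose proof (kern_den_Re b z Hb) as H. destruct Hb as [Hc Hr].
  pose proof (Re_le_Cmod (1 + snd b - Cconj (fst b) * z)%C).
  split; [lra|]. split; [lra|].
  rewrite <- Cmod_one_sub_conj by assumption. apply Cmod_ge_sqr. rewrite Cmod2_alt.
  pose proof (Re_one_sub_conj (fst b) z Hc) as H1.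
  rewrite re_minus, re_RtoC in H1 |- *.
  assert (E1 : Re (1 + snd b - Cconj (fst b) * z)%C = 1 + snd b - Re (Cconj (fst b) * z)%C)
    by (rewrite re_minus, re_plus, !re_RtoC; reflexivity).
  assert (E2 : Im (1 + snd b - Cconj (fst b) * z)%C = Im (1 - Cconj (fst b) * z)%C)
    by (simpl; ring).
  rewrite E1, E2. nra.
Qed.

Lemma kern_Re_ge_0 (b : C * R) (z : C) : arc b -> Cmod z <= 1 -> 0 <= Re (kern b z).
Proof.
  intros Hb Hz. pose proof (kern_den_Re b z Hb). destruct Hb as [Hc Hr].
  unfold kern. rewrite re_scal_l. apply Rmult_le_pos; [lra|]. left. apply Re_inv_pos. lra.
Qed.

Lemma Cmod_kern (b : C * R) (z : C) : arc b -> Cmod z <= 1 ->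
  Cmod (kern b z) = snd b * / Cmod (1 + snd b - Cconj (fst b) * z)%C.
Proof.
  intros Hb Hz. pose proof (kern_den_Cmod b z Hb Hz) as [H _]. destruct Hb as [Hc Hr].
  unfold kern. rewrite Cmod_mult, Cmod_R, Rabs_pos_eq by lra. f_equal.
  apply Cmod_inv, Cmod_gt_0. lra.
Qed.

Lemma Cmod_kern_le (b : C * R) (z : C) (d : R) : arc b -> Cmod z <= 1 -> 0 < d ->
  d <= Cmod (1 + snd b - Cconj (fst b) * z)%C -> Cmod (kern b z) <= snd b / d.
Proof.
  intros Hb Hz Hd H. rewrite Cmod_kern by assumption. destruct Hb as [Hc Hr].
  apply Rmult_le_compat_l; [lra|]. apply Rinv_le_contravar; assumption.
Qed.

(** The denominator [w] has real part at least [rho] and modulus at most [2 * rho], so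
    [rho * Re w >= |w|^2 / 4]. *)
Lemma kern_Re_arc (b : C * R) (z : C) : arc b -> Cmod z = 1 -> Cmod (z - fst b)%C <= snd b ->
  1 / 4 <= Re (kern b z).
Proof.
  intros Hb Hz H. pose proof (kern_den_Re b z Hb) as H1. destruct Hb as [Hc Hr].
  unfold kern. rewrite re_scal_l, Re_inv.
  set (w := (1 + snd b - Cconj (fst b) * z)%C) in *.
  assert (H2 : Cmod w <= 2 * snd b).
  { replace w with (snd b + (1 - Cconj (fst b) * z))%C by (unfold w; ring).
    eapply Rle_trans; [apply Cmod_triangle|].
    rewrite Cmod_one_sub_conj, Cmod_R, Rabs_pos_eq; lra. }
  pose proof (Re_le_Cmod w).
  assert (0 < Cmod w ^ 2) by (apply pow_lt; lra).
  apply Rmult_le_reg_r with (Cmod w ^ 2); [assumption|].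
  replace (snd b * (Re w / Cmod w ^ 2) * Cmod w ^ 2) with (snd b * Re w) by (field; lra). nra.
Qed.

Lemma kern_analytic (b : C * R) : arc b -> analytic 1 (kern b).
Proof.
  intros Hb. pose proof Hb as [Hc Hr].
  apply (analytic_mul 1 (fun _ => RtoC (snd b))); [lra | apply analytic_const |].
  apply analytic_inv with (snd b); try lra.
  - apply (analytic_add 1 (fun _ => (1 + snd b)%C)); [apply analytic_const|].
    destruct (analytic_mul 1 (fun _ => (- Cconj (fst b))%C) (fun z => z)) as [M [HM HQ]];
      [lra | apply analytic_const | apply analytic_id; lra |].
    exists M. split; [assumption|]. eapply qana_ext; [|exact HQ]. intros; simpl; ring.
  - intros z Hz. apply kern_den_Cmod; assumption.
Qed.

(** A resolvent identity. It supplies the explicit divided difference that [poisson_formula] takes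
    as input. *)
Lemma kern_sub (b : C * R) (z a : C) : arc b -> Cmod z <= 1 -> Cmod a <= 1 ->
  (kern b z - kern b a = (z - a) * (Cconj (fst b) * / snd b * kern b a * kern b z))%C.
Proof.
  intros Hb Hz Ha. pose proof (kern_den_Cmod b z Hb Hz) as [H1 _].
  pose proof (kern_den_Cmod b a Hb Ha) as [H2 _]. destruct Hb as [Hc Hr].
  unfold kern. field.
  repeat split; first [apply Cmod_gt_0; lra | intros E; apply RtoC_inj in E; lra].
Qed.

(** The constant of [qana_inv] with [M = 3 / (1 - rad)], for the denominator divided by its lower
    bound [1 - rad]. The factor [rho] stays outside, so that the bounds for a potential add up to
    its mass. *)
Definition kern_bound (rad : R) : R := 1 / (1 - rad) * (1 + 3 / (1 - rad) + 9 * (3 / (1 - rad)) ^ 2).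

Lemma kern_bound_pos (rad : R) : rad < 1 -> 0 < kern_bound rad.
Proof.
  intros H. unfold kern_bound.
  assert (0 < 1 / (1 - rad)) by (apply Rdiv_lt_0_compat; lra).
  assert (0 < 3 / (1 - rad)) by (apply Rdiv_lt_0_compat; lra).
  apply Rmult_lt_0_compat; nra.
Qed.

Lemma kern_qana (b : C * R) (rad : R) : arc b -> snd b <= 1 -> rad < 1 ->
  qana rad (snd b * kern_bound rad) (kern b).
Proof.
  intros Hb H1 Hr. pose proof Hb as [Hc Hp].
  set (s := 1 / (1 - rad)). assert (Hs : 0 < s) by (apply Rdiv_lt_0_compat; lra).
  assert (Q : qana rad 3 (fun z => (1 + snd b) + (- Cconj (fst b)) * z)%C).
  { apply qana_weaken with (Cmod (1 + snd b)%C + Cmod (- Cconj (fst b))%C * 1).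
    - rewrite Cmod_opp, Cmod_conj, Hc.
      pose proof (Cmod_triangle 1 (snd b)) as T. rewrite Cmod_1, Cmod_R, Rabs_pos_eq in T; lra.
    - apply qana_add; [apply qana_const|]. apply qana_scal, qana_id. lra. }
  apply (qana_scal _ _ _ (RtoC s)) in Q. rewrite Cmod_R, (Rabs_pos_eq s) in Q by lra.
  apply qana_inv in Q; try lra.
  - apply (qana_scal _ _ _ (RtoC (snd b * s))) in Q.
    rewrite Cmod_R, Rabs_pos_eq in Q by nra.
    assert (E : snd b * kern_bound rad = snd b * s * (1 + s * 3 + 9 * (s * 3) ^ 2)).
    { unfold kern_bound, s. field. lra. }
    rewrite E. eapply qana_ext; [|exact Q].
    intros z Hz. simpl. unfold kern.
    pose proof (kern_den_Cmod b z Hb ltac:(lra)) as [D _].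
    replace (1 + snd b + - Cconj (fst b) * z)%C with (1 + snd b - Cconj (fst b) * z)%C by ring.
    rewrite RtoC_mult. field. split; [apply Cmod_gt_0; lra|].
    intros E'; apply RtoC_inj in E'; lra.
  - intros z Hz. rewrite Cmod_mult, Cmod_R, Rabs_pos_eq by lra.
    pose proof (kern_den_Cmod b z Hb ltac:(lra)) as [_ [D _]].
    replace (1 + snd b + - Cconj (fst b) * z)%C with (1 + snd b - Cconj (fst b) * z)%C by ring.
    replace 1 with (s * (1 - rad)) at 1 by (unfold s; field; lra).
    apply Rmult_le_compat_l; lra.
Qed.

Lemma mass_ge_0 V : List.Forall arc V -> 0 <= mass V.
Proof.
  unfold mass. induction 1 as [|b V [_ Hb] _ IH]; simpl; lra.
Qed.

Lemma pot_Re_ge_0 V z : List.Forall arc V -> Cmod z <= 1 -> 0 <= Re (pot V z).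
Proof.
  intros HV Hz. induction HV as [|b V Hb _ IH]; simpl pot; [simpl; lra|].
  rewrite re_plus. pose proof (kern_Re_ge_0 b z Hb Hz). lra.
Qed.

Lemma pot_Re_covers V z : List.Forall arc V -> Cmod z = 1 -> covers V z -> 1 / 4 <= Re (pot V z).
Proof.
  intros HV Hz H. unfold covers in H. induction HV as [|b V Hb HV IH]; [inversion H|]. simpl pot.
  rewrite re_plus. pose proof (kern_Re_ge_0 b z Hb ltac:(lra)).
  pose proof (pot_Re_ge_0 V z HV ltac:(lra)).
  inversion H; subst.
  - pose proof (kern_Re_arc b z Hb Hz ltac:(assumption)). lra.
  - specialize (IH ltac:(assumption)). lra.
Qed.

Lemma Cmod_pot_le V z d : List.Forall arc V -> Cmod z <= 1 -> 0 < d ->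
  (forall b, In b V -> d <= Cmod (1 + snd b - Cconj (fst b) * z)%C) -> Cmod (pot V z) <= mass V / d.
Proof.
  intros HV Hz Hd H. unfold mass. induction HV as [|b V Hb HV IH]; simpl.
  - rewrite Cmod_0. unfold Rdiv. lra.
  - eapply Rle_trans; [apply Cmod_triangle|].
    pose proof (Cmod_kern_le b z d Hb Hz Hd (H b (or_introl eq_refl))).
    specialize (IH (fun b' Hb' => H b' (or_intror Hb'))).
    rewrite Rdiv_plus_distr. lra.
Qed.

Lemma Cmod_pot_interior V z : List.Forall arc V -> Cmod z < 1 -> Cmod (pot V z) <= mass V / (1 - Cmod z).
Proof.
  intros HV Hz. apply Cmod_pot_le; try lra; try assumption.
  intros b Hb. apply kern_den_Cmod; [|lra]. rewrite Forall_forall in HV. auto.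
Qed.

Lemma Cmod_pot_radial V zeta r d : List.Forall arc V -> Cmod zeta = 1 -> 0 <= r <= 1 -> 0 < d ->
  (forall b, In b V -> d <= Cmod (zeta - fst b)%C) -> Cmod (pot V (r * zeta)%C) <= 2 * mass V / d.
Proof.
  intros HV Hz Hr Hd H. replace (2 * mass V / d) with (mass V / (d / 2)) by (field; lra).
  assert (Hm : Cmod (r * zeta)%C <= 1) by (rewrite Cmod_radial; lra).
  apply Cmod_pot_le; try lra; try assumption.
  intros b Hb. rewrite Forall_forall in HV. specialize (HV b Hb). specialize (H b Hb).
  pose proof (kern_den_Cmod b (r * zeta)%C HV Hm) as [_ [_ D]].
  pose proof (Cmod_radial_sub (fst b) zeta r (proj1 HV) Hz Hr). lra.
Qed.

Lemma pot_analytic V : List.Forall arc V -> analytic 1 (pot V).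
Proof.
  induction 1 as [|b V Hb HV IH]; simpl.
  - apply analytic_const.
  - apply analytic_add; [apply kern_analytic|]; assumption.
Qed.

Lemma pot_divided_difference V a : List.Forall arc V -> Cmod a <= 1 -> exists D, analytic 1 D /\
  forall z, Cmod z <= 1 -> (pot V z - pot V a = (z - a) * D z)%C.
Proof.
  intros HV Ha. induction HV as [|b V Hb HV [D [HD IH]]]; simpl.
  - exists (fun _ => RtoC 0). split; [apply analytic_const|]. intros; ring.
  - exists (fun z => (Cconj (fst b) * / snd b * kern b a * kern b z) + D z)%C. split.
    + apply analytic_add; [|assumption].
      apply (analytic_mul 1 (fun _ => Cconj (fst b) * / snd b * kern b a)%C);
        [lra | apply analytic_const | apply kern_analytic, Hb].
    + intros z Hz.
      replace (kern b z + pot V z - (kern b a + pot V a))%C with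
        ((kern b z - kern b a) + (pot V z - pot V a))%C by ring.
      rewrite IH, (kern_sub b z a) by assumption. ring.
Qed.

Lemma pot_qana V rad : List.Forall arc V -> mass V <= 1 -> rad < 1 ->
  qana rad (mass V * kern_bound rad) (pot V).
Proof.
  intros HV Hm Hr. unfold mass in *. induction HV as [|b V Hb HV IH]; simpl in *.
  - apply qana_weaken with (Cmod 0); [rewrite Cmod_0; lra | apply qana_const].
  - pose proof (mass_ge_0 V HV) as H0. unfold mass in H0. pose proof (proj2 Hb).
    rewrite Rmult_plus_distr_r. apply qana_add; [apply kern_qana; try assumption; lra | apply IH; lra].
Qed.

(** * Positive real part *)

Lemma Re_pos_add_neq_0 (p : C) (l : R) : 0 <= Re p -> 0 < l -> (p + l)%C <> 0.
Proof. intros. apply Re_pos_neq_0. rewrite re_plus, re_RtoC. lra. Qed.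

Lemma Cmod_add_pos (p : C) (l : R) : 0 <= Re p -> 0 < l -> l <= Cmod (p + l)%C /\ Cmod p <= Cmod (p + l)%C.
Proof.
  intros Hp Hl. split.
  - pose proof (Re_le_Cmod (p + l)%C) as H. rewrite re_plus, re_RtoC in H. lra.
  - apply Cmod_ge_sqr. rewrite Cmod2_alt, re_plus, re_RtoC.
    replace (Im (p + l)%C) with (Im p) by (destruct p; simpl; ring). nra.
Qed.

Lemma Re_div_add (p : C) (l : R) : 0 <= Re p -> 0 < l ->
  Re (p * / (p + l))%C = (Cmod p ^ 2 + l * Re p) / Cmod (p + l)%C ^ 2.
Proof.
  intros Hp Hl. rewrite !Cmod2_alt. destruct p as [x y]. simpl in *. field.
  apply Rgt_not_eq. nra.
Qed.

Lemma Cmod_add_sqr (p : C) (l : R) : Cmod (p + l)%C ^ 2 = Cmod p ^ 2 + 2 * l * Re p + l ^ 2.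
Proof. rewrite !Cmod2_alt. destruct p; simpl; ring. Qed.

(** The map [p / (p + l)] takes the right half-plane into the disc with diameter [[0, 1]]. *)
Lemma Re_div_add_bounds (p : C) (l : R) : 0 <= Re p -> 0 < l -> 0 <= Re (p * / (p + l))%C <= 1.
Proof.
  intros Hp Hl. rewrite Re_div_add by assumption.
  pose proof (pow2_ge_0 (Cmod p)). rewrite Cmod_add_sqr.
  assert (D : 0 < Cmod p ^ 2 + 2 * l * Re p + l ^ 2) by nra.
  split.
  - apply Rdiv_le_0_compat; nra.
  - apply Rmult_le_reg_r with (Cmod p ^ 2 + 2 * l * Re p + l ^ 2); [assumption|].
    unfold Rdiv. rewrite Rmult_assoc, Rinv_l by lra. nra.
Qed.

(** The half-circle [|p| = l] goes to the line [Re = 1 / 2]. Largeness of the full modulus,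
    imaginary part included, thus shows in a bounded real part. *)
Lemma Re_div_add_half (p : C) (l : R) : 0 <= Re p -> 0 < l -> l <= Cmod p -> 1 / 2 <= Re (p * / (p + l))%C.
Proof.
  intros Hp Hl H. rewrite Re_div_add by assumption.
  pose proof (pow2_ge_0 (Cmod p)). rewrite Cmod_add_sqr.
  assert (D : 0 < Cmod p ^ 2 + 2 * l * Re p + l ^ 2) by nra.
  assert (l ^ 2 <= Cmod p ^ 2) by (apply pow_incr; lra).
  apply (proj1 (Rle_div_r _ _ _ D)). nra.
Qed.

Lemma Cmod_div_add (p : C) (l : R) : 0 <= Re p -> 0 < l ->
  Cmod (p * / (p + l))%C <= 1 /\ Cmod (p * / (p + l))%C <= Cmod p / l.
Proof.
  intros Hp Hl. destruct (Cmod_add_pos p l Hp Hl) as [H1 H2].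
  pose proof (Cmod_ge_0 p).
  rewrite Cmod_mult, Cmod_inv by (apply Re_pos_add_neq_0; assumption).
  split.
  - apply Rmult_le_reg_r with (Cmod (p + l)%C); [lra|]. rewrite Rmult_assoc, Rinv_l by lra. lra.
  - apply Rmult_le_compat_l; [assumption|]. apply Rinv_le_contravar; lra.
Qed.

(** The value [1 / 5] is [p / (p + 1)] at [p = 1 / 4], the bound of [pot_Re_covers]. *)
Lemma Re_div_add_fifth (p : C) : 1 / 4 <= Re p -> 1 / 5 <= Re (p * / (p + 1))%C.
Proof.
  intros Hp. rewrite (Re_div_add p 1) by lra. rewrite Cmod_add_sqr.
  pose proof (Re_le_Cmod p).
  assert (D : 0 < Cmod p ^ 2 + 2 * 1 * Re p + 1 ^ 2) by nra.
  apply (proj1 (Rle_div_r _ _ _ D)). nra.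
Qed.

(** * Parametrization of the circle and finite nets *)

Lemma expi_surj (z : C) : Cmod z = 1 -> exists t, 0 <= t <= 2 * PI /\ z = expi t.
Proof.
  intros Hz. destruct z as [x y].
  assert (E : x ^ 2 + y ^ 2 = 1).
  { pose proof (Cmod2_alt (x, y)) as H. rewrite Hz in H. simpl in *. lra. }
  assert (Hx : -1 <= x <= 1) by nra.
  pose proof (acos_bound x) as Hb. pose proof (cos_acos x Hx) as Hc. pose proof (sin_acos x Hx) as Hs.
  replace (1 - Rsqr x) with (Rsqr y) in Hs by (unfold Rsqr; lra).
  rewrite sqrt_Rsqr_abs in Hs.
  destruct (Rle_dec 0 y) as [Hy|Hy].
  - exists (acos x). split; [lra|]. unfold expi. rewrite Hc, Hs, Rabs_pos_eq by assumption. reflexivity.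
  - exists (2 * PI - acos x). split; [lra|]. unfold expi.
    rewrite cos_minus, sin_minus, cos_2PI, sin_2PI, Hc, Hs, Rabs_left by lra. f_equal; ring.
Qed.

Lemma circle_net (d : R) : 0 < d -> exists T : list C,
  forall z, Cmod z = 1 -> exists p, In p T /\ Cmod (z - p)%C <= d.
Proof.
  intros Hd. pose proof PI_RGT_0.
  destruct (INR_unbounded (2 * PI / (d / 2))) as [N HN].
  (* The mesh is [d / 2] because [expi] is 2-Lipschitz. *)
  exists (map (fun k => expi (INR k * (d / 2))) (seq 0 (S N))).
  intros z Hz. destruct (expi_surj z Hz) as [t [Ht ->]].
  set (k := Z.to_nat (Int_part (t / (d / 2)))).
  assert (Hq : 0 <= t / (d / 2)) by (apply Rdiv_le_0_compat; lra).
  destruct (base_Int_part (t / (d / 2))) as [I1 I2].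
  assert (I0 : (0 <= Int_part (t / (d / 2)))%Z).
  { assert (-1 < Int_part (t / (d / 2)))%Z; [|lia]. apply lt_IZR. simpl. lra. }
  assert (Hk : INR k = IZR (Int_part (t / (d / 2)))).
  { unfold k. rewrite INR_IZR_INZ, Z2Nat.id by assumption. reflexivity. }
  exists (expi (INR k * (d / 2))). split.
  - apply in_map_iff. exists k. split; [reflexivity|]. apply in_seq.
    assert (HkN : INR k < INR (S N)).
    { rewrite S_INR, Hk. apply Rle_lt_trans with (t / (d / 2)); [assumption|].
      apply Rle_lt_trans with (2 * PI / (d / 2)); [|lra].
      apply Rmult_le_compat_r; [|lra]. left. apply Rinv_0_lt_compat. lra. }
    apply INR_lt in HkN. lia.
  - eapply Rle_trans; [apply expi_lip|]. rewrite Hk.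
    assert (E : t = t / (d / 2) * (d / 2)) by (field; lra).
    rewrite E at 1. rewrite <- Rmult_minus_distr_r, Rabs_mult, (Rabs_pos_eq (d / 2)) by lra.
    rewrite Rabs_pos_eq by lra. nra.
Qed.

(** * Disjoint subfamilies *)

Lemma filter_length_lt {T : Type} (f : T -> bool) (L : list T) (x : T) :
  In x L -> f x = false -> (length (filter f L) < length L)%nat.
Proof.
  induction L as [|y L IH]; simpl; [tauto|]. intros [->|H] Hf.
  - rewrite Hf. pose proof (filter_length_le f L). lia.
  - specialize (IH H Hf). destruct (f y); simpl; lia.
Qed.

Lemma exists_largest (L : list (C * R)) : L <> nil ->
  exists b, In b L /\ forall b', In b' L -> snd b' <= snd b.
Proof.
  induction L as [|b L IH]; [tauto|]. intros _. destruct L as [|b1 L].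
  - exists b. split; [left; reflexivity|]. intros b' [->|[]]. lra.
  - destruct IH as [m [Hm1 Hm2]]; [discriminate|].
    destruct (Rle_dec (snd m) (snd b)) as [H|H].
    + exists b. split; [left; reflexivity|]. intros b' [->|Hb']; [lra|]. specialize (Hm2 b' Hb'). lra.
    + exists m. split; [right; assumption|]. intros b' [->|Hb']; [lra|]. apply Hm2, Hb'.
Qed.

Definition separated (K : R) (b b' : C * R) : Prop := K * (snd b + snd b') <= Cmod (fst b - fst b')%C.

(** Greedy choice by decreasing radius: an arc [b] discarded because of the largest arc [m] has its
    centre closer than [K * (snd m + snd b) <= 2 * K * snd m]. *)
Lemma vitali (K : R) (L : list (C * R)) : 0 < K -> (forall b, In b L -> 0 < snd b) ->
  exists L', incl L' L /\ ForallOrdPairs (separated K) L' /\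
    forall b, In b L -> exists b', In b' L' /\ snd b <= snd b' /\
      Cmod (fst b - fst b')%C <= 2 * K * snd b'.
Proof.
  intros HK. remember (length L) as n eqn:En.
  assert (Hn : (length L <= n)%nat) by lia. clear En. revert L Hn.
  induction n as [|n IH]; intros L Hn HL.
  - destruct L; [|simpl in Hn; lia]. exists nil.
    split; [apply incl_nil_l|]. split; [constructor|]. intros b [].
  - destruct L as [|x L0] eqn:EL.
    { exists nil. split; [apply incl_nil_l|]. split; [constructor|]. intros b []. }
    rewrite <- EL in *. destruct (exists_largest L) as [m [Hm1 Hm2]]; [rewrite EL; discriminate|].
    set (f := fun b => if Rle_dec (K * (snd m + snd b)) (Cmod (fst m - fst b)%C) then true else false).
    assert (Fm : f m = false).
    { unfold f. destruct (Rle_dec _ _) as [H|H]; [|reflexivity]. exfalso.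
      replace (fst m - fst m)%C with (RtoC 0) in H by ring. rewrite Cmod_0 in H.
      specialize (HL m Hm1). nra. }
    destruct (IH (filter f L)) as [L' [I1 [I2 I3]]].
    { pose proof (filter_length_lt f L m Hm1 Fm). lia. }
    { intros b Hb. apply HL. apply filter_In in Hb. tauto. }
    exists (m :: L'). split; [|split].
    + intros b [<-|Hb]; [assumption|]. apply I1 in Hb. apply filter_In in Hb. tauto.
    + constructor; [|assumption]. apply List.Forall_forall. intros b Hb. apply I1 in Hb.
      apply filter_In in Hb. destruct Hb as [_ Hb]. unfold f in Hb. unfold separated.
      destruct (Rle_dec _ _); [assumption | discriminate].
    + intros b Hb. destruct (f b) eqn:Fb.
      * destruct (I3 b) as [b' [J1 J2]]; [apply filter_In; tauto|].
        exists b'. split; [right; assumption | assumption].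
      * exists m. split; [left; reflexivity|]. split; [apply Hm2, Hb|].
        unfold f in Fb. destruct (Rle_dec _ _) as [|H]; [discriminate|].
        rewrite Cmod_sub_sym. specialize (Hm2 b Hb). nra.
Qed.

(** * The maximal estimate *)

(** A trapezoid, [1] within [32 * rho] of the centre and [0] beyond [64 * rho]. The slope keeps
    integrands Lipschitz; the outer radius explains the separation constant [64]. *)
Definition cutoff (b : C * R) (z : C) : R := Rmax 0 (Rmin 1 (2 - Cmod (z - fst b)%C / (32 * snd b))).

Lemma cutoff_bounds b z : 0 <= cutoff b z <= 1.
Proof.
  unfold cutoff. split; [apply Rmax_l|]. apply Rmax_lub; [lra | apply Rmin_l].
Qed.

Lemma cutoff_near b z : 0 < snd b -> Cmod (z - fst b)%C <= 32 * snd b -> cutoff b z = 1.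
Proof.
  intros Hb H. unfold cutoff.
  assert (Cmod (z - fst b)%C / (32 * snd b) <= 1).
  { apply Rmult_le_reg_r with (32 * snd b); [lra|]. unfold Rdiv. rewrite Rmult_assoc, Rinv_l by lra. lra. }
  rewrite Rmin_left by lra. apply Rmax_right. lra.
Qed.

Lemma cutoff_far b z : 0 < snd b -> 64 * snd b <= Cmod (z - fst b)%C -> cutoff b z = 0.
Proof.
  intros Hb H. unfold cutoff.
  assert (2 <= Cmod (z - fst b)%C / (32 * snd b)).
  { apply Rmult_le_reg_r with (32 * snd b); [lra|]. unfold Rdiv. rewrite Rmult_assoc, Rinv_l by lra. lra. }
  apply Rmax_left. eapply Rle_trans; [apply Rmin_r|]. lra.
Qed.

Lemma Rabs_clip_sub (x y : R) : Rabs (Rmax 0 (Rmin 1 y) - Rmax 0 (Rmin 1 x)) <= Rabs (y - x).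
Proof.
  unfold Rmax, Rmin. repeat destruct (Rle_dec _ _); unfold Rabs; repeat destruct (Rcase_abs _); lra.
Qed.

Lemma cutoff_lip b x y : 0 < snd b ->
  Rabs (cutoff b (expi y) - cutoff b (expi x)) <= (2 / (32 * snd b)) * Rabs (y - x).
Proof.
  intros Hb. unfold cutoff. eapply Rle_trans; [apply Rabs_clip_sub|].
  replace (2 - Cmod (expi y - fst b)%C / (32 * snd b) - (2 - Cmod (expi x - fst b)%C / (32 * snd b)))
    with ((Cmod (expi x - fst b)%C - Cmod (expi y - fst b)%C) / (32 * snd b)) by (field; lra).
  unfold Rdiv at 1. rewrite Rabs_mult, (Rabs_pos_eq (/ _)) by (left; apply Rinv_0_lt_compat; lra).
  assert (H : Rabs (Cmod (expi x - fst b)%C - Cmod (expi y - fst b)%C) <= 2 * Rabs (y - x)).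
  { eapply Rle_trans; [|apply expi_lip]. apply Rabs_le.
    pose proof (Cmod_triangle_sub (expi x) (expi y) (fst b)) as T1.
    pose proof (Cmod_triangle_sub (expi y) (expi x) (fst b)) as T2.
    rewrite (Cmod_sub_sym (expi x) (expi y)) in T1. lra. }
  apply Rle_trans with (2 * Rabs (y - x) * / (32 * snd b)); [|right; unfold Rdiv; ring].
  apply Rmult_le_compat_r; [|assumption]. left; apply Rinv_0_lt_compat; lra.
Qed.

Lemma poisson_chord (c z : C) (h : R) : Cmod c = 1 -> Cmod z = 1 -> 0 < h <= 1 ->
  poisson ((1 - h) * c) z = h * (2 - h) / (h ^ 2 + (1 - h) * Cmod (z - c)%C ^ 2).
Proof.
  intros Hc Hz Hh. unfold poisson. rewrite <- (RtoC_minus 1 h), Cmod_radial by (assumption || lra).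
  f_equal; [ring|]. f_equal.
  assert (E1 : Re c ^ 2 + Im c ^ 2 = 1) by (rewrite <- Cmod2_alt, Hc; ring).
  assert (E2 : Re z ^ 2 + Im z ^ 2 = 1) by (rewrite <- Cmod2_alt, Hz; ring).
  rewrite !Cmod2_alt. destruct c as [a b], z as [x y]. simpl in *.
  apply Rminus_diag_uniq.
  (* The two denominators differ by multiples of [|z|^2 - 1] and [|c|^2 - 1]. *)
  transitivity (h * (x * x + y * y - 1) - h * (1 - h) * (a * a + b * b - 1)); [ring|].
  replace (x * x + y * y - 1) with 0 by lra. replace (a * a + b * b - 1) with 0 by lra. ring.
Qed.

Lemma poisson_ge_0 (a z : C) : Cmod a <= 1 -> 0 <= poisson a z.
Proof.
  intros Ha. unfold poisson. pose proof (Cmod_ge_0 a).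
  destruct (Req_dec (Cmod (z - a)%C) 0) as [E|E].
  - rewrite E. unfold Rdiv. rewrite pow_i, Rinv_0 by lia. lra.
  - apply Rdiv_le_0_compat; [nra|]. pose proof (Cmod_ge_0 (z - a)%C). apply pow_lt. lra.
Qed.

(* The tail of a Poisson kernel of height [h] is small relative to the one of height [32 h]. *)
Lemma poisson_cutoff (c z : C) (h : R) : Cmod c = 1 -> Cmod z = 1 -> 0 < h -> 64 * h <= 1 ->
  poisson ((1 - h) * c) z <= 2 / h * cutoff (c, h) z + 1 / 4 * poisson ((1 - 32 * h) * c) z.
Proof.
  intros Hc Hz Hh Hh1.
  assert (P : 0 <= poisson ((1 - 32 * h) * c) z).
  { apply poisson_ge_0. replace (1 - 32 * h)%C with (RtoC (1 - 32 * h)) by (rewrite RtoC_minus, RtoC_mult; reflexivity).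
    rewrite Cmod_radial; lra. }
  destruct (Rle_dec (Cmod (z - c)%C) (32 * h)) as [H|H].
  - rewrite (cutoff_near (c, h) z Hh H). rewrite poisson_chord by (assumption || lra).
    set (d := Cmod (z - c)%C) in *. assert (0 <= d) by apply Cmod_ge_0.
    assert (h * (2 - h) / (h ^ 2 + (1 - h) * d ^ 2) <= 2 / h * 1).
    { apply Rle_div_l; [nra|]. replace (2 / h * 1 * (h ^ 2 + (1 - h) * d ^ 2)) with
        (2 * h + 2 / h * ((1 - h) * d ^ 2)) by (field; lra).
      assert (0 <= 2 / h) by (apply Rdiv_le_0_compat; lra).
      assert (0 <= (1 - h) * d ^ 2) by (apply Rmult_le_pos; nra). nra. }
    lra.
  - pose proof (cutoff_bounds (c, h) z).
    assert (0 <= 2 / h) by (apply Rdiv_le_0_compat; lra).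
    apply Rle_trans with (1 / 4 * poisson ((1 - 32 * h) * c) z); [|nra].
    replace (1 - 32 * h)%C with (1 - RtoC (32 * h))%C by (rewrite RtoC_mult; reflexivity).
    rewrite !poisson_chord by (assumption || lra).
    set (d := Cmod (z - c)%C) in *.
    (* Since [32 * h < d], the kernel of height [h] is at most [4 h / d^2] and that of height [32 h]
       at least [16 h / d^2]. *)
    apply Rle_trans with (4 * h / d ^ 2).
    + assert (0 < d ^ 2) by nra. apply Rle_div_l; [nra|].
      replace (4 * h / d ^ 2 * (h ^ 2 + (1 - h) * d ^ 2)) with
        (4 * h * (1 - h) + 4 * h / d ^ 2 * h ^ 2) by (field; nra).
      assert (0 <= 4 * h / d ^ 2) by (apply Rdiv_le_0_compat; nra). nra.
    + assert (D : 0 < (32 * h) ^ 2 + (1 - 32 * h) * d ^ 2) by nra.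
      assert (0 < d ^ 2) by nra.
      assert (Q : 16 * h / d ^ 2 <= 32 * h * (2 - 32 * h) / ((32 * h) ^ 2 + (1 - 32 * h) * d ^ 2)).
      { apply (proj1 (Rle_div_r _ _ _ D)).
        replace (16 * h / d ^ 2 * ((32 * h) ^ 2 + (1 - 32 * h) * d ^ 2)) with
          (16 * h * ((32 * h) ^ 2 / d ^ 2 + (1 - 32 * h))) by (field; lra).
        assert ((32 * h) ^ 2 / d ^ 2 <= 1) by (apply Rle_div_l; nra). nra. }
      apply Rle_trans with (1 / 4 * (16 * h / d ^ 2)); [right; field; lra | lra].
Qed.

(** Separation makes the sets where the cutoffs are nonzero disjoint, so at most one summand
    survives. *)
Lemma cutoff_sum_le_1 (L : list (C * R)) (z : C) : List.Forall arc L -> ForallOrdPairs (separated 64) L ->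
  lsum (fun b => cutoff b z) L <= 1.
Proof.
  intros HA HS. induction HS as [|b L Hb HS IH]; simpl; [lra|].
  inversion HA as [|? ? Ab AL]; subst. specialize (IH AL).
  destruct (Rle_dec (64 * snd b) (Cmod (z - fst b)%C)) as [H|H].
  - rewrite cutoff_far by (assumption || apply Ab). lra.
  - assert (E : lsum (fun b' => cutoff b' z) L = 0).
    { clear IH HS HA. induction Hb as [|b' L Hb' Hb IH]; simpl; [reflexivity|].
      inversion AL as [|? ? Ab' AL']; subst. rewrite IH by assumption.
      rewrite cutoff_far; [lra | apply Ab'|].
      unfold separated in Hb'. pose proof (Cmod_triangle_sub (fst b) z (fst b')) as T.
      rewrite (Cmod_sub_sym (fst b) z) in T. lra. }
    rewrite E. pose proof (cutoff_bounds b z). lra.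
Qed.

Lemma lsum_le {T : Type} (f g : T -> R) L : (forall b, In b L -> f b <= g b) -> lsum f L <= lsum g L.
Proof.
  induction L as [|b L IH]; simpl; intros H; [lra|].
  pose proof (H b (or_introl eq_refl)). specialize (IH (fun b' Hb' => H b' (or_intror Hb'))). lra.
Qed.

Lemma lsum_scal {T : Type} (f : T -> R) (k : R) L : lsum (fun b => k * f b) L = k * lsum f L.
Proof. induction L as [|b L IH]; simpl; [ring|]. rewrite IH. ring. Qed.

Lemma RInt_lsum {T : Type} (f : T -> R -> R) (L : list T) (a b : R) :
  (forall x, In x L -> ex_RInt (f x) a b) ->
  ex_RInt (fun t => lsum (fun x => f x t) L) a b /\
  RInt (fun t => lsum (fun x => f x t) L) a b = lsum (fun x => RInt (f x) a b) L.
Proof.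
  induction L as [|x L IH]; simpl; intros H.
  - destruct (RInt_const_R 0 a b) as [X E]. split; [exact X|]. rewrite E. ring.
  - destruct IH as [X E]; [intros; apply H; right; assumption|].
    destruct (RInt_plus_R _ _ _ _ (H x (or_introl eq_refl)) X) as [X' E'].
    split; [exact X'|]. rewrite E', E. reflexivity.
Qed.

Section Maximal.
Variables (V : list (C * R)) (l : R).
Hypothesis HV : List.Forall arc V.
Hypothesis Hl : 0 < l.

(** An analytic substitute for the indicator of the set where [|pot V| >= l]: its real part lies in
    [[0, 1]] and is at least [1 / 2] on that set. *)
Let F (z : C) : C := (pot V z * / (pot V z + l))%C.

Let F_Re (z : C) : Cmod z <= 1 -> 0 <= Re (F z) <= 1.
Proof. intros Hz. apply Re_div_add_bounds; [apply pot_Re_ge_0; assumption | assumption]. Qed.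

Let F_analytic : analytic 1 F.
Proof.
  unfold F. pose proof (pot_analytic V HV) as HP. apply analytic_mul; [lra | exact HP |].
  apply analytic_inv with l; try lra.
  - apply analytic_add; [exact HP | apply analytic_const].
  - intros z Hz. apply Cmod_add_pos; [apply pot_Re_ge_0; assumption | assumption].
Qed.

Let F_poisson (a : C) : Cmod a < 1 ->
  ex_RInt (fun t => Re (F (expi t)) * poisson a (expi t)) 0 (2 * PI) /\
  RInt (fun t => Re (F (expi t)) * poisson a (expi t)) 0 (2 * PI) = 2 * PI * Re (F a).
Proof.
  intros Ha. destruct (pot_divided_difference V a HV ltac:(lra)) as [D [HD E]].
  assert (NZ : forall z, Cmod z <= 1 -> (pot V z + l)%C <> 0).
  { intros z Hz. apply Re_pos_add_neq_0; [apply pot_Re_ge_0; assumption | assumption]. }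
  (* As [F = 1 - l / (pot V + l)], its divided difference is that of the potential times
     [l / ((pot V a + l) * (pot V z + l))]. *)
  apply poisson_formula with (D := fun z => (l * / (pot V a + l) * (D z * / (pot V z + l)))%C).
  - assumption.
  - apply analytic_mul; [lra | apply analytic_const |].
    apply analytic_mul; [lra | exact HD |].
    apply analytic_inv with l; try lra.
    + apply analytic_add; [apply pot_analytic, HV | apply analytic_const].
    + intros z Hz. apply Cmod_add_pos; [apply pot_Re_ge_0; assumption | assumption].
  - intros z Hz.
    transitivity (l * / (pot V a + l) * / (pot V z + l) * (pot V z - pot V a))%C.
    + unfold F. field. split; apply NZ; lra.
    + rewrite E by assumption. ring.
Qed.

(** At the given point [Re F >= 1 / 2]. In its Poisson average the wide kernel of [poisson_cutoff]
    contributes at most [1 / 4], since it averages a function bounded by [1]; the other [1 / 4] must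
    come from the cutoff, whose weight is [2 / h]. *)
Lemma maximal_height (b : C * R) : arc b -> 64 * snd b <= 1 -> l <= Cmod (pot V ((1 - snd b) * fst b)%C) ->
  ex_RInt (fun t => Re (F (expi t)) * cutoff b (expi t)) 0 (2 * PI) /\
  2 * PI * snd b <= 8 * RInt (fun t => Re (F (expi t)) * cutoff b (expi t)) 0 (2 * PI).
Proof.
  intros [Hc Hh] Hh1 HP. destruct b as [c h]. simpl fst in *. simpl snd in *.
  pose proof PI_RGT_0.
  assert (X : ex_RInt (fun t => Re (F (expi t)) * cutoff (c, h) (expi t)) 0 (2 * PI)).
  { destruct F_analytic as [M [HM HQ]].
    apply lip_ex_RInt with (6 * M + 2 / (32 * h)). intros x y.
    replace (Re (F (expi y)) * cutoff (c, h) (expi y) - Re (F (expi x)) * cutoff (c, h) (expi x)) with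
      ((Re (F (expi y)) - Re (F (expi x))) * cutoff (c, h) (expi y)
       + Re (F (expi x)) * (cutoff (c, h) (expi y) - cutoff (c, h) (expi x))) by ring.
    eapply Rle_trans; [apply Rabs_triang|]. rewrite !Rabs_mult.
    pose proof (qana_expi_lip _ _ HQ x y) as L1. pose proof (cutoff_lip (c, h) x y Hh) as L2.
    simpl snd in L2.
    pose proof (cutoff_bounds (c, h) (expi y)). pose proof (F_Re (expi x) ltac:(rewrite Cmod_expi; lra)).
    rewrite (Rabs_pos_eq (cutoff _ _)), (Rabs_pos_eq (Re _)) by lra.
    pose proof (Rabs_pos (Re (F (expi y)) - Re (F (expi x)))).
    pose proof (Rabs_pos (cutoff (c, h) (expi y) - cutoff (c, h) (expi x))).
    nra. }
  split; [exact X|].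
  assert (E1 : Cmod ((1 - h) * c)%C = 1 - h) by (rewrite <- RtoC_minus; apply Cmod_radial; lra).
  assert (E2 : Cmod ((1 - 32 * h) * c)%C = 1 - 32 * h).
  { rewrite <- RtoC_mult, <- RtoC_minus. apply Cmod_radial; lra. }
  destruct (F_poisson ((1 - h) * c)%C ltac:(lra)) as [X1 V1].
  destruct (F_poisson ((1 - 32 * h) * c)%C ltac:(lra)) as [X2 V2].
  destruct (RInt_scal_R _ (2 / h) _ _ X) as [X3 V3].
  destruct (RInt_scal_R _ (1 / 4) _ _ X2) as [X4 V4].
  destruct (RInt_plus_R _ _ _ _ X3 X4) as [X5 V5].
  assert (I : RInt (fun t => Re (F (expi t)) * poisson ((1 - h) * c) (expi t)) 0 (2 * PI)
    <= 2 / h * RInt (fun t => Re (F (expi t)) * cutoff (c, h) (expi t)) 0 (2 * PI)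
       + 1 / 4 * (2 * PI * Re (F ((1 - 32 * h) * c)%C))).
  { rewrite <- V2, <- V3, <- V4, <- V5. apply RInt_le; try assumption; [lra|].
    intros t _. pose proof (poisson_cutoff c (expi t) h Hc (Cmod_expi t) Hh Hh1) as Q.
    pose proof (F_Re (expi t) ltac:(rewrite Cmod_expi; lra)). nra. }
  rewrite V1 in I.
  pose proof (F_Re ((1 - 32 * h) * c)%C ltac:(lra)) as B2.
  pose proof (Re_div_add_half _ l (pot_Re_ge_0 V ((1 - h) * c)%C HV ltac:(lra)) Hl HP) as B1.
  fold (F ((1 - h) * c)%C) in B1.
  set (J := RInt (fun t => Re (F (expi t)) * cutoff (c, h) (expi t)) 0 (2 * PI)) in *.
  assert (K : PI / 2 <= 2 / h * J) by nra.
  apply Rmult_le_compat_l with (r := 4 * h) in K; [|lra].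
  replace (4 * h * (2 / h * J)) with (8 * J) in K by (field; lra). lra.
Qed.

(** The cutoffs sum to at most [1], so the estimates of [maximal_height] add up to at most eight
    times the integral of [Re F], that is [16 * PI * Re (F 0)], and [|F 0| <= mass V / l]. *)
Lemma maximal_sum (L : list (C * R)) : List.Forall arc L -> ForallOrdPairs (separated 64) L ->
  (forall b, In b L -> 64 * snd b <= 1 /\ l <= Cmod (pot V ((1 - snd b) * fst b)%C)) ->
  mass L <= 8 * mass V / l.
Proof.
  intros HA HS HL. pose proof PI_RGT_0. rewrite List.Forall_forall in HA.
  assert (P : forall b, In b L -> _) by (intros b Hb; destruct (HL b Hb); exact (maximal_height b (HA b Hb) ltac:(assumption) ltac:(assumption))).
  destruct (RInt_lsum (fun b t => Re (F (expi t)) * cutoff b (expi t)) L 0 (2 * PI)) as [X E].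
  { intros b Hb. apply (P b Hb). }
  assert (X1 : ex_RInt (fun t => Re (F (expi t))) 0 (2 * PI)).
  { destruct F_analytic as [M [HM HQ]]. apply lip_ex_RInt with (6 * M). apply qana_expi_lip, HQ. }
  assert (V1 : RInt (fun t => Re (F (expi t))) 0 (2 * PI) = 2 * PI * Re (F 0)).
  { destruct F_analytic as [M [HM HQ]]. exact (mean_value _ _ HQ). }
  assert (S1 : 2 * PI * mass L <= 8 * RInt (fun t => Re (F (expi t))) 0 (2 * PI)).
  { apply Rle_trans with (8 * RInt (fun t => lsum (fun b => Re (F (expi t)) * cutoff b (expi t)) L) 0 (2 * PI)).
    - rewrite E. unfold mass. rewrite <- !lsum_scal. apply lsum_le. intros b Hb. apply (P b Hb).
    - apply Rmult_le_compat_l; [lra|]. apply RInt_le; try assumption; [lra|]. intros t _.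
      rewrite lsum_scal. pose proof (F_Re (expi t) ltac:(rewrite Cmod_expi; lra)).
      pose proof (cutoff_sum_le_1 L (expi t) (proj2 (List.Forall_forall _ _) HA) HS). nra. }
  rewrite V1 in S1.
  assert (B : Re (F 0) <= mass V / l).
  { eapply Rle_trans; [apply Re_le_Cmod|].
    assert (Z : Cmod 0 <= 1) by (rewrite Cmod_0; lra).
    eapply Rle_trans; [apply Cmod_div_add; [apply pot_Re_ge_0; assumption | assumption]|].
    apply Rmult_le_compat_r; [left; apply Rinv_0_lt_compat; assumption|].
    pose proof (Cmod_pot_interior V 0 HV ltac:(rewrite Cmod_0; lra)) as Q.
    rewrite Cmod_0, Rminus_0_r, Rdiv_1_r in Q. exact Q. }
  apply Rmult_le_reg_l with (2 * PI); [lra|].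
  eapply Rle_trans; [exact S1|]. replace (2 * PI * (8 * mass V / l)) with (8 * (2 * PI * (mass V / l))) by (field; lra).
  nra.
Qed.

End Maximal.

(** One witness near each net point is enough, since an arc of radius at least [2 * d] around it
    contains all points within [d] of that net point. Raising the height [1 - r] to at least [2 * d]
    moves the evaluation point by at most [2 * d], where the Lipschitz hypothesis loses at most
    [l / 2]. The original level [l] is also recorded, to locate the centres later. *)
Lemma maximal_cover_net (V : list (C * R)) (l d : R) (T : list C) : List.Forall arc V ->
  0 < l -> 0 < d -> 2 * d <= 1 ->
  (forall z w, Cmod z <= 1 -> Cmod w <= 1 -> Cmod (pot V w - pot V z)%C * (2 * d) <= l / 2 * Cmod (w - z)%C) ->
  exists S : list (C * R),
    (forall b, In b S -> Cmod (fst b) = 1 /\ 0 < snd b <= 1 /\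
       l / 2 <= Cmod (pot V ((1 - snd b) * fst b)%C) /\
       exists r, 0 <= r < 1 /\ l <= Cmod (pot V (r * fst b)%C)) /\
    forall p zeta r, In p T -> Cmod (zeta - p)%C <= d -> Cmod zeta = 1 -> 0 <= r < 1 ->
      l <= Cmod (pot V (r * zeta)%C) -> covers S zeta.
Proof.
  intros HV Hl Hd Hd1 HL. induction T as [|p T [S [S1 S2]]].
  { exists nil. split; [intros b []|]. intros p zeta r []. }
  destruct (classic (exists zeta r, Cmod (zeta - p)%C <= d /\ Cmod zeta = 1 /\ 0 <= r < 1 /\
    l <= Cmod (pot V (r * zeta)%C))) as [[c [r [Hc1 [Hc2 [Hr HP]]]]]|N].
  - set (h := Rmax (1 - r) (2 * d)).
    assert (Hh1 : 1 - r <= h) by apply Rmax_l. assert (Hh2 : 2 * d <= h) by apply Rmax_r.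
    assert (Hh3 : h <= 1) by (apply Rmax_lub; lra).
    assert (Hh4 : h - (1 - r) <= 2 * d) by (unfold h, Rmax; destruct (Rle_dec _ _); lra).
    exists ((c, h) :: S). split.
    + intros b [<-|Hb]; [|apply S1, Hb]. simpl.
      split; [assumption|]. split; [lra|]. split; [|exists r; split; assumption].
      rewrite <- RtoC_minus.
      specialize (HL ((1 - h)%R * c)%C (r * c)%C).
      rewrite !Cmod_radial in HL by (assumption || lra). specialize (HL ltac:(lra) ltac:(lra)).
      assert (E : Cmod (r * c - (1 - h)%R * c)%C = h - (1 - r)).
      { replace (r * c - (1 - h)%R * c)%C with (RtoC (h - (1 - r)) * c)%C
          by (rewrite !RtoC_minus; ring).
        apply Cmod_radial; [assumption | lra]. }
      rewrite E in HL.
      pose proof (Cmod_rev_triangle (pot V (r * c)%C) (pot V (r * c)%C - pot V ((1 - h)%R * c)%C)%C) as Q.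
      replace (pot V (r * c)%C - (pot V (r * c)%C - pot V ((1 - h)%R * c)%C))%C with
        (pot V ((1 - h)%R * c)%C) in Q by ring.
      assert (Cmod (pot V (r * c)%C - pot V ((1 - h)%R * c)%C)%C <= l / 2); [|lra].
      apply Rmult_le_reg_r with (2 * d); [lra|].
      apply Rle_trans with (1 := HL). apply Rmult_le_compat_l; lra.
    + intros p' zeta r' [<-|Hp] H1 H2 H3 H4.
      * apply Exists_cons_hd. simpl.
        pose proof (Cmod_triangle_sub zeta p c) as Tr. rewrite (Cmod_sub_sym p c) in Tr. lra.
      * apply Exists_cons_tl. apply (S2 p' zeta r'); assumption.
  - exists S. split; [exact S1|]. intros p' zeta r' [<-|Hp] H1 H2 H3 H4.
    + exfalso. apply N. exists zeta, r'. tauto.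
    + apply (S2 p' zeta r'); assumption.
Qed.

(* [2064 = 129 * 16]: a maximal separated subfamily has total radius at most [16 * mass V / l], and the
   selection of disjoint arcs costs a dilation by [129 = 1 + 2 * 64]. *)
Lemma maximal_cover (V : list (C * R)) (l : R) : List.Forall arc V -> 0 < l -> 128 * mass V <= l ->
  exists V', List.Forall arc V' /\ mass V' <= 2064 * mass V / l /\
    (forall zeta r, Cmod zeta = 1 -> 0 <= r < 1 -> l <= Cmod (pot V (r * zeta)%C) -> covers V' zeta) /\
    (forall b, In b V' -> exists r, 0 <= r < 1 /\ l <= Cmod (pot V (r * fst b)%C)).
Proof.
  intros HV Hl Hm. pose proof (mass_ge_0 V HV) as Hm0.
  destruct (pot_analytic V HV) as [M [HM HQ]].
  pose proof (qana_lip 1 M _ (Rle_refl 1) HQ) as HL.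
  set (d := Rmin (1 / 2) (l / (12 * (M + 1)))).
  assert (Hd0 : 0 < d).
  { apply Rmin_pos; [lra|]. apply Rdiv_lt_0_compat; lra. }
  assert (Hd1 : d <= 1 / 2) by apply Rmin_l.
  assert (Hd2 : d <= l / (12 * (M + 1))) by apply Rmin_r.
  destruct (circle_net d Hd0) as [T HT].
  destruct (maximal_cover_net V l d T HV Hl Hd0 ltac:(lra)) as [S [S1 S2]].
  { intros z w Hz Hw. specialize (HL z w Hz Hw). pose proof (Cmod_ge_0 (w - z)%C).
    assert (K : 3 * M * (2 * d) <= l / 2).
    { apply Rle_trans with (6 * (M + 1) * (l / (12 * (M + 1)))); [nra|]. right; field; lra. }
    apply Rle_trans with (3 * M * Cmod (w - z)%C * (2 * d)); [|nra].
    apply Rmult_le_compat_r; [lra | assumption]. }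
  destruct (vitali 64 S ltac:(lra)) as [L [L1 [L2 L3]]].
  { intros b Hb. apply S1, Hb. }
  assert (AL : List.Forall arc L).
  { apply List.Forall_forall. intros b Hb. split; apply S1, L1, Hb. }
  assert (ML : mass L <= 8 * mass V / (l / 2)).
  { apply maximal_sum; try assumption; try lra.
    intros b Hb. destruct (S1 b (L1 b Hb)) as [B1 [B2 [B3 _]]]. split; [|exact B3].
    rewrite <- RtoC_minus in B3.
    pose proof (Cmod_pot_interior V ((1 - snd b)%R * fst b)%C HV) as Q.
    rewrite Cmod_radial in Q by (assumption || lra). specialize (Q ltac:(lra)).
    replace (1 - (1 - snd b)) with (snd b) in Q by ring.
    (* At depth [h] the potential is at most [mass V / h], so the level [l / 2] forces
       [h <= 2 * mass V / l <= 1 / 64]. *)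
    assert (l / 2 * snd b <= mass V).
    { apply Rle_div_r; [lra|]. lra. }
    nra. }
  exists (map (fun b => (fst b, 129 * snd b)) L). split; [|split; [|split]].
  - apply List.Forall_forall. intros b Hb. apply in_map_iff in Hb. destruct Hb as [b0 [<- Hb]].
    rewrite List.Forall_forall in AL. destruct (AL b0 Hb). split; simpl; [assumption | lra].
  - assert (E : mass (map (fun b => (fst b, 129 * snd b)) L) = 129 * mass L).
    { unfold mass. rewrite <- lsum_scal. clear. induction L; simpl; [reflexivity|]. rewrite IHL. reflexivity. }
    rewrite E. replace (2064 * mass V / l) with (129 * (8 * mass V / (l / 2))) by (field; lra). lra.
  - intros zeta r H1 H2 H3. destruct (HT zeta H1) as [p [Hp1 Hp2]].
    pose proof (S2 p zeta r Hp1 Hp2 H1 H2 H3) as HC. unfold covers in *.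
    apply List.Exists_exists in HC. destruct HC as [b [Hb1 Hb2]].
    destruct (L3 b Hb1) as [b' [Hb'1 [Hb'2 Hb'3]]].
    apply List.Exists_exists. exists (fst b', 129 * snd b'). split.
    + apply in_map_iff. exists b'. tauto.
    + simpl. pose proof (Cmod_triangle_sub zeta (fst b) (fst b')). lra.
  - intros b Hb. apply in_map_iff in Hb. destruct Hb as [b0 [<- Hb]]. simpl.
    apply (S1 b0 (L1 b0 Hb)).
Qed.

(** * The averaged bump *)

Definition bump (V : list (C * R)) (z : C) : C := (pot V z * / (pot V z + 1))%C.

Lemma bump_Re V z : List.Forall arc V -> Cmod z <= 1 -> 0 <= Re (bump V z) <= 1.
Proof. intros. apply Re_div_add_bounds; [apply pot_Re_ge_0; assumption | lra]. Qed.

Lemma Cmod_bump V z : List.Forall arc V -> Cmod z <= 1 ->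
  Cmod (bump V z) <= 1 /\ Cmod (bump V z) <= Cmod (pot V z).
Proof.
  intros HV Hz. destruct (Cmod_div_add (pot V z) 1 (pot_Re_ge_0 V z HV Hz) Rlt_0_1) as [H1 H2].
  rewrite Rdiv_1_r in H2. split; assumption.
Qed.

Lemma bump_Re_covers V z : List.Forall arc V -> Cmod z = 1 -> covers V z -> 1 / 5 <= Re (bump V z).
Proof. intros. apply Re_div_add_fifth, pot_Re_covers; assumption. Qed.

Lemma bump_analytic V : List.Forall arc V -> analytic 1 (bump V).
Proof.
  intros HV. apply analytic_mul; [lra | apply pot_analytic, HV |].
  apply analytic_inv with 1; try lra.
  - apply analytic_add; [apply pot_analytic, HV | apply analytic_const].
  - intros z Hz. apply (Cmod_add_pos (pot V z) 1); [apply pot_Re_ge_0; assumption | lra].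
Qed.

(** The constant of [qana_mul] for [pot V] and [1 / (pot V + 1)], with the factor [mass V] taken
    out. *)
Definition bump_bound (rad : R) : R :=
  5 * kern_bound rad * (1 + (kern_bound rad + 1) + 9 * (kern_bound rad + 1) ^ 2).

Lemma bump_bound_pos rad : rad < 1 -> 0 <= bump_bound rad.
Proof.
  intros H. pose proof (kern_bound_pos rad H). unfold bump_bound. apply Rmult_le_pos; nra.
Qed.

Lemma bump_qana V rad : List.Forall arc V -> mass V <= 1 -> rad < 1 ->
  qana rad (mass V * bump_bound rad) (bump V).
Proof.
  intros HV Hm Hr. pose proof (pot_qana V rad HV Hm Hr) as HP.
  pose proof (mass_ge_0 V HV). pose proof (kern_bound_pos rad Hr) as HK.
  unfold bump_bound.
  replace (mass V * (5 * kern_bound rad * (1 + (kern_bound rad + 1) + 9 * (kern_bound rad + 1) ^ 2)))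
    with (5 * (mass V * kern_bound rad) * (1 + (kern_bound rad + 1) + 9 * (kern_bound rad + 1) ^ 2)) by ring.
  apply qana_mul; try assumption; try nra.
  apply qana_inv; try lra.
  - apply qana_weaken with (mass V * kern_bound rad + Cmod 1); [rewrite Cmod_1; nra|].
    apply qana_add; [assumption | apply qana_const].
  - intros z Hz. apply (Cmod_add_pos (pot V z) 1); [apply pot_Re_ge_0; [assumption | lra] | lra].
Qed.

Fixpoint Csum (F : nat -> C) (n : nat) : C :=
  match n with O => RtoC 0 | S n => (Csum F n + F n)%C end.

Fixpoint Rsum (F : nat -> R) (n : nat) : R :=
  match n with O => 0 | S n => Rsum F n + F n end.

Lemma Re_Csum F n : Re (Csum F n) = Rsum (fun k => Re (F k)) n.
Proof. induction n as [|n IH]; simpl Csum; [reflexivity|]. rewrite re_plus, IH. reflexivity. Qed.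

Lemma Cmod_Csum F n : Cmod (Csum F n) <= Rsum (fun k => Cmod (F k)) n.
Proof.
  induction n as [|n IH]; simpl; [rewrite Cmod_0; lra|].
  eapply Rle_trans; [apply Cmod_triangle | lra].
Qed.

Lemma Rsum_le F G n : (forall k, (k < n)%nat -> F k <= G k) -> Rsum F n <= Rsum G n.
Proof.
  induction n as [|n IH]; simpl; intros H; [lra|].
  pose proof (H n ltac:(lia)). specialize (IH (fun k Hk => H k ltac:(lia))). lra.
Qed.

Lemma Rsum_const c n : Rsum (fun _ => c) n = INR n * c.
Proof. induction n as [|n IH]; simpl Rsum; [simpl; ring|]. rewrite S_INR, IH. ring. Qed.

Lemma Rsum_plus F G n : Rsum (fun k => F k + G k) n = Rsum F n + Rsum G n.
Proof. induction n as [|n IH]; simpl; [ring|]. rewrite IH. ring. Qed.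

Lemma Rsum_scal c F n : Rsum (fun k => c * F k) n = c * Rsum F n.
Proof. induction n as [|n IH]; simpl; [ring|]. rewrite IH. ring. Qed.

Lemma Rsum_ge_0 F n : (forall k, (k < n)%nat -> 0 <= F k) -> 0 <= Rsum F n.
Proof.
  intros H. apply Rle_trans with (Rsum (fun _ => 0) n); [rewrite Rsum_const; lra|]. apply Rsum_le, H.
Qed.

Lemma qana_Csum rad (M : nat -> R) F n : (forall k, (k < n)%nat -> qana rad (M k) (F k)) ->
  qana rad (Rsum M n) (fun z => Csum (fun k => F k z) n).
Proof.
  induction n as [|n IH]; simpl; intros H.
  - apply qana_weaken with (Cmod 0); [rewrite Cmod_0; lra | apply qana_const].
  - apply qana_add; [apply IH; intros; apply H; lia | apply H; lia].
Qed.

Lemma exists_fun {A B : Type} (P : A -> B -> Prop) : (forall x, exists y, P x y) ->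
  exists f : A -> B, forall x, P x (f x).
Proof.
  intros H. exists (fun x => proj1_sig (constructive_indefinite_description _ (H x))).
  intros x. apply proj2_sig.
Qed.

(** On the arcs the potential is at least [1 / 4], and continuity up to the circle carries any level
    below that slightly inside. Hence points covered by one family of a chain remain covered by the
    next. *)
Lemma covers_radial (V : list (C * R)) (zeta : C) (l : R) : List.Forall arc V -> Cmod zeta = 1 ->
  0 < l < 1 / 4 -> covers V zeta -> exists r, 0 <= r < 1 /\ l <= Cmod (pot V (r * zeta)%C).
Proof.
  intros HV Hz Hl HC. destruct (pot_analytic V HV) as [M [HM HQ]].
  pose proof (qana_lip 1 M _ (Rle_refl 1) HQ) as HL.
  pose proof (pot_Re_covers V zeta HV Hz HC) as P1. pose proof (Re_le_Cmod (pot V zeta)) as P2.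
  set (d := Rmin 1 ((1 / 4 - l) / (3 * M + 1))).
  assert (D0 : 0 < d) by (apply Rmin_pos; [lra | apply Rdiv_lt_0_compat; lra]).
  assert (D1 : d <= 1) by apply Rmin_l.
  assert (D2 : d <= (1 / 4 - l) / (3 * M + 1)) by apply Rmin_r.
  assert (D3 : 3 * M * d <= 1 / 4 - l).
  { apply Rle_trans with ((3 * M + 1) * ((1 / 4 - l) / (3 * M + 1))); [nra|]. right; field; lra. }
  exists (1 - d). split; [lra|].
  specialize (HL ((1 - d)%R * zeta)%C zeta). rewrite Cmod_radial in HL by (assumption || lra).
  specialize (HL ltac:(lra) ltac:(lra)).
  replace (zeta - (1 - d)%R * zeta)%C with (d * zeta)%C in HL by (rewrite RtoC_minus; ring).
  rewrite Cmod_radial in HL by (assumption || lra).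
  pose proof (Cmod_rev_triangle (pot V zeta) (pot V zeta - pot V ((1 - d)%R * zeta)%C)%C) as Q.
  replace (pot V zeta - (pot V zeta - pot V ((1 - d)%R * zeta)%C))%C with (pot V ((1 - d)%R * zeta)%C)
    in Q by ring. lra.
Qed.

(* Every arc of the chain [W] lies where the previous potential is large, and the next bump
   dominates the radial maximal function of the previous one up to an error [1 / N]. *)
Lemma maximal_chain (N : nat) (V : list (C * R)) : (5 <= N)%nat -> List.Forall arc V ->
  128 * INR N * (2064 * INR N) ^ N * mass V <= 1 ->
  exists W : nat -> list (C * R), W O = V /\
    (forall k, (k <= N)%nat -> List.Forall arc (W k) /\ mass (W k) <= (2064 * INR N) ^ N * mass V) /\
    forall k, (k < N)%nat ->
      (forall zeta r, Cmod zeta = 1 -> 0 <= r < 1 -> / INR N <= Cmod (pot (W k) (r * zeta)%C) ->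
         covers (W (S k)) zeta) /\
      (forall b, In b (W (S k)) -> exists r, 0 <= r < 1 /\ / INR N <= Cmod (pot (W k) (r * fst b)%C)).
Proof.
  intros HN HV Hm. pose proof (mass_ge_0 V HV) as Hm0.
  assert (HN5 : 5 <= INR N) by (apply (le_INR 5) in HN; simpl in HN; lra).
  set (c := 2064 * INR N) in *. assert (Hc : 1 <= c) by (unfold c; lra).
  assert (Hl : 0 < / INR N) by (apply Rinv_0_lt_compat; lra).
  destruct (exists_fun (fun V V' : list (C * R) => List.Forall arc V -> 128 * mass V <= / INR N ->
    List.Forall arc V' /\ mass V' <= 2064 * mass V / / INR N /\
    (forall zeta r, Cmod zeta = 1 -> 0 <= r < 1 -> / INR N <= Cmod (pot V (r * zeta)%C) -> covers V' zeta) /\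
    (forall b, In b V' -> exists r, 0 <= r < 1 /\ / INR N <= Cmod (pot V (r * fst b)%C)))) as [f Hf].
  { intros X. destruct (classic (List.Forall arc X /\ 128 * mass X <= / INR N)) as [[H1 H2]|H].
    - destruct (maximal_cover X (/ INR N) H1 Hl H2) as [X' HX]. exists X'. intros _ _. exact HX.
    (* The choice function has to be total; outside the hypotheses any list will do. *)
    - exists nil. tauto. }
  set (W := fun k => Nat.iter k f V).
  assert (Hp : forall k, (k <= N)%nat -> c ^ k <= c ^ N) by (intros; apply Rle_pow; assumption).
  (* The bound on [mass V] is calibrated so that, even after [N] multiplications by [c], the mass
     meets the smallness condition of [maximal_cover] at level [1 / N]. *)
  assert (Hs : forall k, (k <= N)%nat -> mass (W k) <= c ^ k * mass V -> 128 * mass (W k) <= / INR N).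
  { intros k Hk H. apply Rmult_le_reg_l with (INR N); [lra|]. rewrite Rinv_r by lra.
    specialize (Hp k Hk).
    apply Rle_trans with (128 * INR N * (c ^ N * mass V)); [|lra].
    replace (INR N * (128 * mass (W k))) with (128 * INR N * mass (W k)) by ring.
    apply Rmult_le_compat_l; [lra|]. nra. }
  assert (HW : forall k, (k <= N)%nat -> List.Forall arc (W k) /\ mass (W k) <= c ^ k * mass V).
  { induction k as [|k IH]; intros Hk.
    - simpl. split; [assumption | lra].
    - destruct (IH ltac:(lia)) as [I1 I2].
      destruct (Hf (W k) I1 (Hs k ltac:(lia) I2)) as [F1 [F2 _]].
      split; [exact F1|]. change (W (S k)) with (f (W k)).
      replace (2064 * mass (W k) / / INR N) with (c * mass (W k)) in F2 by (unfold c; field; lra).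
      simpl. nra. }
  exists W. split; [reflexivity|]. split.
  - intros k Hk. destruct (HW k Hk) as [H1 H2]. split; [assumption|].
    specialize (Hp k Hk). nra.
  - intros k Hk. destruct (HW k ltac:(lia)) as [H1 H2].
    apply (Hf (W k) H1 (Hs k ltac:(lia) H2)).
Qed.

Lemma Rsum_shift F n : Rsum (fun k => F (S k)) n = Rsum F n + F n - F O.
Proof. induction n as [|n IH]; simpl; [ring|]. rewrite IH. ring. Qed.

(** [K] depends on [N] alone, so the arcs can be shortened after [N] is fixed. The bound [5 <= N]
    puts the level [1 / N] below the [1 / 4] attained on arcs. The last clause is locality: it will
    make the sum converge off the open set. *)
Lemma averaged_bump (N : nat) : (5 <= N)%nat -> exists K, 0 < K /\
  forall V, List.Forall arc V -> K * mass V <= 1 -> exists G : C -> C,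
    analytic 1 G /\
    (forall z, Cmod z <= 1 -> 0 <= Re (G z)) /\
    (forall zeta r, Cmod zeta = 1 -> 0 <= r < 1 -> Cmod (G (r * zeta)%C) <= 5 * Re (G zeta) + 6 / INR N) /\
    (forall zeta, Cmod zeta = 1 -> covers V zeta -> 1 / 5 <= Re (G zeta)) /\
    (forall rad, rad < 1 -> qana rad (K * mass V * bump_bound rad) G) /\
    (forall zeta d, Cmod zeta = 1 -> 0 < d -> (forall b, In b V -> d <= Cmod (zeta - fst b)%C) ->
       K * mass V <= d -> Cmod (G zeta) <= K * mass V / d).
Proof.
  intros HN. assert (HN5 : 5 <= INR N) by (apply (le_INR 5) in HN; simpl in HN; lra).
  set (n := INR N) in *. set (c := (2064 * n) ^ N).
  assert (Hc : 1 <= c) by (apply pow_R1_Rle; lra).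
  exists (128 * n ^ 2 * c). split; [apply Rmult_lt_0_compat; nra|].
  intros V HV Hm. pose proof (mass_ge_0 V HV) as Hm0.
  assert (Hcm : 0 <= c * mass V) by nra.
  assert (HK4 : 4 * (c * mass V) <= 128 * n ^ 2 * c * mass V).
  { replace (128 * n ^ 2 * c * mass V) with (c * mass V * (128 * n ^ 2)) by ring.
    rewrite (Rmult_comm 4). apply Rmult_le_compat_l; [assumption | nra]. }
  destruct (maximal_chain N V HN HV) as [W [W0 [W1 W2]]].
  { fold n. fold c. nra. }
  fold n in W1, W2. fold c in W1.
  assert (Hn : 0 < / n) by (apply Rinv_0_lt_compat; lra).
  assert (Hn5 : / n <= / 5) by (apply Rinv_le_contravar; lra).
  assert (Dn : Cmod (/ n)%C = / n).
  { rewrite <- RtoC_inv by lra. rewrite Cmod_R, Rabs_pos_eq; lra. }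
  assert (Rn : forall z, Re (/ n * z)%C = / n * Re z).
  { intros z. rewrite <- RtoC_inv by lra. apply re_scal_l. }
  assert (Nn : forall x, / n * (n * x) = x) by (intros; field; lra).
  (* Points of the initial arcs stay covered at every stage, so each term of the average is at least
     [1 / 5] there. *)
  assert (HCW : forall k zeta, (k <= N)%nat -> Cmod zeta = 1 -> covers V zeta -> covers (W k) zeta).
  { induction k as [|k IH]; intros zeta Hk Hz HC; [rewrite W0; assumption|].
    destruct (covers_radial (W k) zeta (/ n)) as [r [R1 R2]]; try assumption.
    - apply W1; lia.
    - lra.
    - apply IH; [lia | assumption | assumption].
    - apply (proj1 (W2 k ltac:(lia)) zeta r); assumption. }
  exists (fun z => (/ n * Csum (fun k => bump (W k) z) N)%C).
  split; [|split; [|split; [|split; [|split]]]].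
  - apply analytic_mul; [lra | apply analytic_const |].
    assert (A : forall k, (k <= N)%nat -> analytic 1 (fun z => Csum (fun k => bump (W k) z) k)).
    { induction k as [|k IH]; intros Hk; simpl; [apply analytic_const|].
      apply analytic_add; [apply IH; lia | apply bump_analytic, W1; lia]. }
    apply A. lia.
  - intros z Hz. rewrite Rn, Re_Csum. apply Rmult_le_pos; [lra|]. apply Rsum_ge_0.
    intros k Hk. apply bump_Re; [apply W1; lia | assumption].
  - intros zeta r Hz Hr. rewrite Cmod_mult, Dn, Rn, Re_Csum.
    set (f := fun k => Re (bump (W k) zeta)).
    (* Either the potential is below [1 / n] at the interior point, and so is the bump, or [zeta] is
       covered by the next family and [5 * f (S k) >= 1] dominates. *)
    assert (B : forall k, (k < N)%nat -> Cmod (bump (W k) (r * zeta)%C) <= 5 * f (S k) + / n).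
    { intros k Hk. assert (Hrz : Cmod (r * zeta)%C <= 1) by (rewrite Cmod_radial; lra).
      destruct (Cmod_bump (W k) (r * zeta)%C) as [B1 B2]; [apply W1; lia | assumption |].
      assert (B3 : 0 <= f (S k)) by (apply bump_Re; [apply W1; lia | lra]).
      destruct (Rle_dec (/ n) (Cmod (pot (W k) (r * zeta)%C))) as [L|L]; [|lra].
      pose proof (bump_Re_covers (W (S k)) zeta (proj1 (W1 (S k) ltac:(lia))) Hz
        (proj1 (W2 k Hk) zeta r Hz Hr L)) as B4. unfold f in *. lra. }
    assert (S1 : Cmod (Csum (fun k => bump (W k) (r * zeta)%C) N) <= 5 * Rsum f N + 6).
    { eapply Rle_trans; [apply Cmod_Csum|]. eapply Rle_trans; [apply Rsum_le, B|].
      (* The shift of the index trades [f 0 >= 0] for [f N <= 1] and costs at most [5]; the [N]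
         errors [1 / n] add one more, hence [6]. *)
      rewrite Rsum_plus, Rsum_scal, Rsum_const, Rsum_shift. fold n.
      assert (f N <= 1) by (apply bump_Re; [apply W1; lia | lra]).
      assert (0 <= f O) by (apply bump_Re; [apply W1; lia | lra]).
      rewrite Rinv_r by lra. lra. }
    apply Rle_trans with (/ n * (5 * Rsum f N + 6)); [apply Rmult_le_compat_l; lra|].
    right. unfold Rdiv. ring.
  - intros zeta Hz HC. rewrite Rn, Re_Csum.
    rewrite <- (Nn (1 / 5)). apply Rmult_le_compat_l; [lra|]. unfold n. rewrite <- Rsum_const.
    apply Rsum_le. intros k Hk. apply bump_Re_covers; [apply W1; lia | assumption |].
    apply HCW; [lia | assumption | assumption].
  - intros rad Hrad. pose proof (bump_bound_pos rad Hrad) as HB.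
    pose proof (qana_Csum rad (fun _ => c * mass V * bump_bound rad) (fun k => bump (W k)) N) as Q.
    rewrite Rsum_const in Q. fold n in Q.
    apply qana_weaken with (Cmod (/ n)%C * (n * (c * mass V * bump_bound rad))).
    + rewrite Dn, Nn. apply Rmult_le_compat_r; [assumption|]. lra.
    + apply qana_scal, Q. intros k Hk. destruct (W1 k ltac:(lia)) as [A1 A2].
      apply qana_weaken with (mass (W k) * bump_bound rad); [apply Rmult_le_compat_r; assumption|].
      apply bump_qana; try assumption. eapply Rle_trans; [exact A2|]. lra.
  - intros zeta d Hz Hd HVd Hmd.
    (* Centres drift by less than [e] from one family to the next, hence by at most [d / 2] over the
       whole chain. *)
    set (e := d / (2 * n)).
    assert (He : 0 < e) by (apply Rdiv_lt_0_compat; lra).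
    assert (Ne : n * e = d / 2) by (unfold e; field; lra).
    assert (He2 : 2 * n * (c * mass V) < e).
    { apply Rmult_lt_reg_l with n; [lra|]. rewrite Ne.
      replace (128 * n ^ 2 * c * mass V) with (128 * (n * (n * (c * mass V)))) in Hmd by ring.
      replace (n * (2 * n * (c * mass V))) with (2 * (n * (n * (c * mass V)))) by ring.
      assert (0 <= n * (n * (c * mass V))) by (repeat apply Rmult_le_pos; nra). lra. }
    assert (Near : forall k b, (k <= N)%nat -> In b (W k) -> exists b0, In b0 V /\
      Cmod (fst b - fst b0)%C <= INR k * e).
    { induction k as [|k IH]; intros b Hk Hb.
      - rewrite W0 in Hb. exists b. split; [assumption|].
        replace (fst b - fst b)%C with (RtoC 0) by ring. rewrite Cmod_0. simpl. lra.
      - destruct (proj2 (W2 k ltac:(lia)) b Hb) as [r [R1 R2]].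
        assert (Ab : Cmod (fst b) = 1).
        { pose proof (proj1 (W1 (S k) Hk)) as A. rewrite List.Forall_forall in A. apply (A b Hb). }
        destruct (classic (exists b1, In b1 (W k) /\ Cmod (fst b - fst b1)%C < e)) as [[b1 [I1 I2]]|NE].
        + destruct (IH b1 ltac:(lia) I1) as [b0 [J1 J2]]. exists b0. split; [assumption|].
          rewrite S_INR. pose proof (Cmod_triangle_sub (fst b) (fst b1) (fst b0)). lra.
        (* If all centres of [W k] were at distance at least [e], its potential along the radius
           would be at most [2 * mass (W k) / e], below the level [1 / n] at which the centre of [b]
           was chosen. *)
        + exfalso. destruct (W1 k ltac:(lia)) as [A1 A2].
          assert (Q : Cmod (pot (W k) (r * fst b)%C) <= 2 * mass (W k) / e).
          { apply Cmod_pot_radial; try assumption; [lra|]. intros b1 H1.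
            destruct (Rle_dec e (Cmod (fst b - fst b1)%C)); [assumption|].
            exfalso. apply NE. exists b1. split; [assumption | lra]. }
          assert (Q2 : / n * e <= 2 * mass (W k)) by (apply Rle_div_r; lra).
          apply Rmult_le_compat_l with (r := n) in Q2; [|lra].
          rewrite <- Rmult_assoc, Rinv_r in Q2 by lra. nra. }
    assert (P : forall k, (k < N)%nat -> Cmod (bump (W k) zeta) <= 4 * (c * mass V) / d).
    { intros k Hk. destruct (W1 k ltac:(lia)) as [A1 A2].
      eapply Rle_trans; [apply Cmod_bump; [assumption | lra]|].
      replace zeta with (1 * zeta)%C by ring.
      apply Rle_trans with (2 * mass (W k) / (d / 2)).
      - apply Cmod_pot_radial; try assumption; try lra. intros b Hb.
        destruct (Near k b ltac:(lia) Hb) as [b0 [I1 I2]]. specialize (HVd b0 I1).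
        pose proof (Cmod_triangle_sub zeta (fst b) (fst b0)).
        assert (INR k <= n) by (apply le_INR; lia). nra.
      - replace (2 * mass (W k) / (d / 2)) with (4 * mass (W k) / d) by (field; lra).
        apply Rmult_le_compat_r; [left; apply Rinv_0_lt_compat; assumption | lra]. }
    rewrite Cmod_mult, Dn.
    apply Rle_trans with (/ n * (n * (4 * (c * mass V) / d))).
    + apply Rmult_le_compat_l; [lra|]. eapply Rle_trans; [apply Cmod_Csum|].
      unfold n. rewrite <- Rsum_const. apply Rsum_le, P.
    + rewrite Nn. apply Rmult_le_compat_r; [left; apply Rinv_0_lt_compat; assumption | exact HK4].
Qed.

(** * Dominated series *)

Definition Cconv (u : nat -> C) (s : C) : Prop :=
  forall eps, 0 < eps -> exists N, forall n, (N <= n)%nat -> Cmod (u n - s)%C <= eps.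

Lemma Cconv_minus u v s t : Cconv u s -> Cconv v t -> Cconv (fun n => u n - v n)%C (s - t)%C.
Proof.
  intros Hu Hv eps He. destruct (Hu (eps / 2)) as [N1 H1]; [lra|]. destruct (Hv (eps / 2)) as [N2 H2]; [lra|].
  exists (Nat.max N1 N2). intros n Hn. specialize (H1 n ltac:(lia)). specialize (H2 n ltac:(lia)).
  replace (u n - v n - (s - t))%C with ((u n - s) - (v n - t))%C by ring.
  eapply Rle_trans; [apply Cmod_sub_le | lra].
Qed.

Lemma Cconv_scal u s (c : C) : Cconv u s -> Cconv (fun n => u n * c)%C (s * c)%C.
Proof.
  intros Hu eps He. pose proof (Cmod_ge_0 c).
  destruct (Hu (eps / (Cmod c + 1))) as [N HN]; [apply Rdiv_lt_0_compat; lra|].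
  exists N. intros n Hn. specialize (HN n Hn).
  replace (u n * c - s * c)%C with ((u n - s) * c)%C by ring. rewrite Cmod_mult.
  apply Rle_trans with (eps / (Cmod c + 1) * (Cmod c + 1)); [|right; field; lra].
  apply Rmult_le_compat; try lra. apply Cmod_ge_0.
Qed.

Lemma Cconv_Cmod_le u s y N : Cconv u s -> (forall n, (N <= n)%nat -> Cmod (u n) <= y) -> Cmod s <= y.
Proof.
  intros Hu Hy. apply le_epsilon. intros eps He. destruct (Hu eps He) as [N1 H1].
  specialize (H1 (Nat.max N N1) ltac:(lia)). specialize (Hy (Nat.max N N1) ltac:(lia)).
  pose proof (Cmod_rev_triangle s (s - u (Nat.max N N1))%C) as Q.
  replace (s - (s - u (Nat.max N N1)))%C with (u (Nat.max N N1)) in Q by ring.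
  rewrite (Cmod_sub_sym s) in Q. lra.
Qed.

Lemma Cconv_Re_ge u s y N : Cconv u s -> (forall n, (N <= n)%nat -> y <= Re (u n)) -> y <= Re s.
Proof.
  intros Hu Hy. apply le_epsilon. intros eps He. destruct (Hu eps He) as [N1 H1].
  specialize (H1 (Nat.max N N1) ltac:(lia)). specialize (Hy (Nat.max N N1) ltac:(lia)).
  pose proof (Re_le_Cmod (u (Nat.max N N1) - s)%C) as Q. rewrite re_minus in Q. lra.
Qed.

(** Only an upper bound is recorded, so that constants may be rounded up; [sums_below_lim] recovers
    the exact sum where small tails are required. *)
Definition sums_below (a : nat -> R) (A : R) : Prop := (forall k, 0 <= a k) /\ forall n, Rsum a n <= A.

Definition tails_vanish (a : nat -> R) (A : R) : Prop :=
  forall eps, 0 < eps -> exists N, forall n, (N <= n)%nat -> A - Rsum a n < eps.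

Lemma Rsum_mono a n m : (forall k, 0 <= a k) -> (n <= m)%nat -> Rsum a n <= Rsum a m.
Proof. intros Ha. induction 1; simpl; [lra|]. pose proof (Ha m). lra. Qed.

Lemma sums_below_lim a A : sums_below a A -> exists S, S <= A /\ sums_below a S /\ tails_vanish a S.
Proof.
  intros [H1 H2].
  destruct (growing_cv (Rsum a)) as [S HS].
  - intros n. simpl. pose proof (H1 n). lra.
  - exists A. intros x [n ->]. apply H2.
  - assert (HB : forall n, Rsum a n <= S).
    { apply growing_ineq; [|exact HS]. intros n. simpl. pose proof (H1 n). lra. }
    exists S. split; [|split; [split; assumption|]].
    + apply Rnot_lt_le. intros HL. destruct (HS (S - A)) as [N HN]; [lra|].
      specialize (HN N (Nat.le_refl N)). specialize (H2 N). unfold Rdist in HN.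
      rewrite Rabs_left1 in HN by (specialize (HB N); lra). lra.
    + intros eps He. destruct (HS eps He) as [N HN]. exists N. intros n Hn.
      specialize (HN n Hn). unfold Rdist in HN. rewrite Rabs_left1 in HN by (specialize (HB n); lra). lra.
Qed.

Lemma Csum_tail_le u a n m : (forall k, Cmod (u k) <= a k) -> (n <= m)%nat ->
  Cmod (Csum u m - Csum u n)%C <= Rsum a m - Rsum a n.
Proof.
  intros Hu. induction 1 as [|m Hm IH].
  - replace (Csum u n - Csum u n)%C with (RtoC 0) by ring. rewrite Cmod_0. lra.
  - simpl. replace (Csum u m + u m - Csum u n)%C with ((Csum u m - Csum u n) + u m)%C by ring.
    eapply Rle_trans; [apply Cmod_triangle|]. specialize (Hu m). lra.
Qed.

Lemma Csum_conv u a A : sums_below a A -> (forall k, Cmod (u k) <= a k) -> exists s, Cconv (Csum u) s.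
Proof.
  intros Ha Hu. destruct (sums_below_lim a A Ha) as [S [_ [[S1 S2] S3]]].
  assert (CC : forall p : C -> R, (forall z w : C, Rabs (p z - p w) <= Cmod (z - w)%C) ->
    exists l, Un_cv (fun n => p (Csum u n)) l).
  { intros p Hp. destruct (Rcomplete.R_complete (fun n => p (Csum u n))) as [l Hl]; [|exists l; exact Hl].
    intros eps He. destruct (S3 eps He) as [N HN]. exists N.
    assert (Q : forall n m, (N <= n)%nat -> (n <= m)%nat -> Rdist (p (Csum u m)) (p (Csum u n)) < eps).
    { intros n m Hn Hm. unfold Rdist. eapply Rle_lt_trans; [apply Hp|].
      eapply Rle_lt_trans; [apply (Csum_tail_le u a n m Hu Hm)|].
      specialize (HN n Hn). specialize (S2 m). lra. }
    intros n m Hn Hm. destruct (Nat.le_ge_cases n m).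
    - rewrite Rdist_sym. apply Q; assumption.
    - apply Q; assumption. }
  destruct (CC Re) as [x Hx].
  { intros z w. rewrite <- re_minus. apply re_le_Cmod. }
  destruct (CC Im) as [y Hy].
  { intros z w. apply (im_le_Cmod (z - w)%C). }
  exists (x, y). intros eps He. destruct (Hx (eps / 2)) as [N1 H1]; [lra|].
  destruct (Hy (eps / 2)) as [N2 H2]; [lra|]. exists (Nat.max N1 N2). intros n Hn.
  specialize (H1 n ltac:(lia)). specialize (H2 n ltac:(lia)). unfold Rdist in *.
  eapply Rle_trans; [apply Cmod_le_Re_Im|].
  change (Rabs (Re (Csum u n) - x) + Rabs (Im (Csum u n) - y) <= eps). lra.
Qed.

(** Total by choice, with an arbitrary value where the partial sums diverge; uses go through a
    summable majorant. *)
Definition Cseries (u : nat -> C) : C := epsilon (inhabits (RtoC 0)) (fun s => Cconv (Csum u) s).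

Lemma Cseries_conv u a A : sums_below a A -> (forall k, Cmod (u k) <= a k) -> Cconv (Csum u) (Cseries u).
Proof.
  intros Ha Hu.
  exact (epsilon_spec (inhabits (RtoC 0)) (fun s => Cconv (Csum u) s) (Csum_conv u a A Ha Hu)).
Qed.

Lemma Cseries_tail u a A n : sums_below a A -> (forall k, Cmod (u k) <= a k) ->
  Cmod (Cseries u - Csum u n)%C <= A - Rsum a n.
Proof.
  intros Ha Hu. pose proof (Cseries_conv u a A Ha Hu) as HC.
  rewrite Cmod_sub_sym.
  assert (HC' : Cconv (fun m => Csum u n - Csum u m)%C (Csum u n - Cseries u)%C).
  { apply Cconv_minus; [|exact HC]. intros eps He. exists O. intros m _.
    replace (Csum u n - Csum u n)%C with (RtoC 0) by ring. rewrite Cmod_0. lra. }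
  apply (Cconv_Cmod_le _ _ _ n HC'). intros m Hm. rewrite Cmod_sub_sym.
  eapply Rle_trans; [apply (Csum_tail_le u a n m Hu Hm)|]. destruct Ha as [_ Ha]. specialize (Ha m). lra.
Qed.

Lemma Cseries_Cmod_le u a A : sums_below a A -> (forall k, Cmod (u k) <= a k) -> Cmod (Cseries u) <= A.
Proof.
  intros Ha Hu. pose proof (Cseries_tail u a A O Ha Hu) as H. simpl in H.
  replace (Cseries u - 0)%C with (Cseries u) in H by ring. lra.
Qed.

Lemma Cseries_Re_ge u a A n : sums_below a A -> (forall k, Cmod (u k) <= a k) -> (forall k, 0 <= Re (u k)) ->
  Rsum (fun k => Re (u k)) n <= Re (Cseries u).
Proof.
  intros Ha Hu Hr. apply (Cconv_Re_ge _ _ _ n (Cseries_conv u a A Ha Hu)).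
  intros m Hm. rewrite Re_Csum. apply Rsum_mono; assumption.
Qed.

(** The inequalities of [qana] are additive in the constant and closed under pointwise limits, so
    they pass from partial sums to the series, with the series of derivatives as derivative. *)
Lemma qana_Cseries rad (M : nat -> R) (F : nat -> C -> C) A : sums_below M A ->
  (forall k, qana rad (M k) (F k)) -> qana rad A (fun z => Cseries (fun k => F k z)).
Proof.
  intros HM HF. destruct (exists_fun _ HF) as [F' HF']. pose proof HM as [HM0 HMA].
  exists (fun z => Cseries (fun k => F' k z)).
  assert (C1 : forall z, Cmod z <= rad -> Cconv (Csum (fun k => F k z)) (Cseries (fun k => F k z))).
  { intros z Hz. apply Cseries_conv with M A; [assumption|]. intros k. apply (HF' k), Hz. }
  assert (C2 : forall z, Cmod z <= rad -> Cconv (Csum (fun k => F' k z)) (Cseries (fun k => F' k z))).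
  { intros z Hz. apply Cseries_conv with M A; [assumption|]. intros k. apply (HF' k), Hz. }
  split.
  - intros z Hz. split; (apply Cseries_Cmod_le with M; [assumption|]; intros k; apply (HF' k), Hz).
  - intros z w Hz Hw.
    apply (Cconv_Cmod_le _ _ _ O (Cconv_minus _ _ _ _ (Cconv_minus _ _ _ _ (C1 w Hw) (C1 z Hz))
      (Cconv_scal _ _ (w - z)%C (C2 z Hz)))).
    intros n _. apply Rle_trans with (Rsum M n * Cmod (w - z)%C ^ 2).
    + induction n as [|n IH]; simpl Csum; simpl Rsum.
      * replace (0 - 0 - 0 * (w - z))%C with (RtoC 0) by ring. rewrite Cmod_0. lra.
      * replace (Csum (fun k => F k w) n + F n w - (Csum (fun k => F k z) n + F n z)
          - (Csum (fun k => F' k z) n + F' n z) * (w - z))%C with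
          ((Csum (fun k => F k w) n - Csum (fun k => F k z) n - Csum (fun k => F' k z) n * (w - z))
           + (F n w - F n z - F' n z * (w - z)))%C by ring.
        eapply Rle_trans; [apply Cmod_triangle|].
        pose proof (proj2 (HF' n) z w Hz Hw). lra.
    + apply Rmult_le_compat_r; [apply pow2_ge_0 | apply HMA].
Qed.

(** * Radial limits *)

(** The condition [d <= 1] keeps [r] nonnegative, so that [r * zeta] has modulus [r]. *)
Definition rlim (f : C -> C) (zeta w : C) : Prop := forall eps, 0 < eps ->
  exists d, 0 < d <= 1 /\ forall r, 1 - d < r < 1 -> Cmod (f (r * zeta) - w)%C < eps.

Lemma rlim_analytic F zeta : analytic 1 F -> Cmod zeta = 1 -> rlim F zeta (F zeta).
Proof.
  intros [M [HM HQ]] Hz eps He. pose proof (qana_lip 1 M F (Rle_refl 1) HQ) as HL.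
  set (d := Rmin 1 (eps / (2 * (3 * M + 1)))).
  assert (D0 : 0 < d) by (apply Rmin_pos; [lra | apply Rdiv_lt_0_compat; lra]).
  assert (D1 : d <= 1) by apply Rmin_l.
  assert (D2 : d <= eps / (2 * (3 * M + 1))) by apply Rmin_r.
  assert (D3 : 3 * M * d < eps).
  { apply Rle_lt_trans with ((3 * M + 1) * (eps / (2 * (3 * M + 1)))); [nra|].
    replace ((3 * M + 1) * (eps / (2 * (3 * M + 1)))) with (eps / 2) by (field; lra). lra. }
  exists d. split; [lra|]. intros r Hr.
  eapply Rle_lt_trans; [apply HL; [lra | rewrite Cmod_radial; lra]|].
  rewrite Cmod_sub_sym. replace (zeta - r * zeta)%C with (RtoC (1 - r) * zeta)%C by (rewrite RtoC_minus; ring).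
  rewrite Cmod_radial by (assumption || lra). nra.
Qed.

Lemma rlim_add F G zeta a b : rlim F zeta a -> rlim G zeta b -> rlim (fun z => F z + G z)%C zeta (a + b)%C.
Proof.
  intros HF HG eps He. destruct (HF (eps / 2)) as [d1 [D1 H1]]; [lra|].
  destruct (HG (eps / 2)) as [d2 [D2 H2]]; [lra|].
  exists (Rmin d1 d2). split; [split; [apply Rmin_pos; lra|]|].
  - eapply Rle_trans; [apply Rmin_l | lra].
  - intros r Hr. pose proof (Rmin_l d1 d2). pose proof (Rmin_r d1 d2).
    specialize (H1 r ltac:(lra)). specialize (H2 r ltac:(lra)).
    replace (F (r * zeta) + G (r * zeta) - (a + b))%C with ((F (r * zeta) - a) + (G (r * zeta) - b))%C by ring.
    eapply Rle_lt_trans; [apply Cmod_triangle | lra].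
Qed.

Lemma rlim_const (c : C) zeta : rlim (fun _ => c) zeta c.
Proof.
  intros eps He. exists 1. split; [lra|]. intros r _.
  replace (c - c)%C with (RtoC 0) by ring. rewrite Cmod_0. assumption.
Qed.

Lemma rlim_scal F (c : C) zeta a : rlim F zeta a -> rlim (fun z => c * F z)%C zeta (c * a)%C.
Proof.
  intros HF eps He. pose proof (Cmod_ge_0 c).
  destruct (HF (eps / (Cmod c + 1))) as [d [D H1]]; [apply Rdiv_lt_0_compat; lra|].
  exists d. split; [assumption|]. intros r Hr. specialize (H1 r Hr).
  replace (c * F (r * zeta) - c * a)%C with (c * (F (r * zeta) - a))%C by ring. rewrite Cmod_mult.
  apply Rle_lt_trans with (Cmod c * (eps / (Cmod c + 1))); [apply Rmult_le_compat_l; lra|].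
  assert (0 < eps / (Cmod c + 1)) by (apply Rdiv_lt_0_compat; lra).
  apply Rlt_le_trans with ((Cmod c + 1) * (eps / (Cmod c + 1))); [nra | right; field; lra].
Qed.

Lemma rlim_Csum (F : nat -> C -> C) zeta (w : nat -> C) n : (forall k, rlim (F k) zeta (w k)) ->
  rlim (fun z => Csum (fun k => F k z) n) zeta (Csum w n).
Proof.
  intros H. induction n as [|n IH]; simpl; [apply rlim_const | apply rlim_add; [exact IH | apply H]].
Qed.

Lemma rlim_Cmod_le F zeta w y : (forall r, 0 <= r < 1 -> Cmod (F (r * zeta)%C) <= y) -> rlim F zeta w -> Cmod w <= y.
Proof.
  intros HB HF. apply le_epsilon. intros eps He. destruct (HF eps He) as [d [D H1]].
  specialize (H1 (1 - d / 2) ltac:(lra)). specialize (HB (1 - d / 2) ltac:(lra)).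
  pose proof (Cmod_triangle_sub w (F ((1 - d / 2)%R * zeta)%C) 0) as T.
  replace (w - 0)%C with w in T by ring.
  replace (F ((1 - d / 2)%R * zeta)%C - 0)%C with (F ((1 - d / 2)%R * zeta)%C) in T by ring.
  rewrite (Cmod_sub_sym w) in T. lra.
Qed.

Lemma rlim_Re_ge F zeta w y : (forall r, 0 <= r < 1 -> y <= Re (F (r * zeta)%C)) -> rlim F zeta w -> y <= Re w.
Proof.
  intros HB HF. apply le_epsilon. intros eps He. destruct (HF eps He) as [d [D H1]].
  specialize (H1 (1 - d / 2) ltac:(lra)). specialize (HB (1 - d / 2) ltac:(lra)).
  pose proof (Re_le_Cmod (F ((1 - d / 2)%R * zeta) - w)%C) as T. rewrite re_minus in T. lra.
Qed.

Lemma rlim_unique F zeta a b : rlim F zeta a -> rlim F zeta b -> a = b.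
Proof.
  intros HA HB. apply Ceq_minus, Cmod_eq_0. apply Rle_antisym; [|apply Cmod_ge_0].
  apply le_epsilon. intros eps He. destruct (HA (eps / 2)) as [d1 [D1 H1]]; [lra|].
  destruct (HB (eps / 2)) as [d2 [D2 H2]]; [lra|].
  pose proof (Rmin_l d1 d2). pose proof (Rmin_r d1 d2).
  assert (0 < Rmin d1 d2) by (apply Rmin_pos; lra).
  specialize (H1 (1 - Rmin d1 d2 / 2) ltac:(lra)). specialize (H2 (1 - Rmin d1 d2 / 2) ltac:(lra)).
  pose proof (Cmod_triangle_sub a (F ((1 - Rmin d1 d2 / 2)%R * zeta)%C) b) as T.
  rewrite (Cmod_sub_sym a (F _)) in T. lra.
Qed.

(** Dominated convergence along one radius: the majorant cuts the tails uniformly in [r], and the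
    limits inherit it. *)
Lemma rlim_Cseries (F : nat -> C -> C) (a : nat -> R) A zeta (w : nat -> C) : sums_below a A ->
  (forall k r, 0 <= r < 1 -> Cmod (F k (r * zeta)%C) <= a k) -> (forall k, rlim (F k) zeta (w k)) ->
  rlim (fun z => Cseries (fun k => F k z)) zeta (Cseries w).
Proof.
  intros Ha HF Hw eps He.
  assert (HW : forall k, Cmod (w k) <= a k).
  { intros k. apply rlim_Cmod_le with (F k) zeta; [apply HF | apply Hw]. }
  (* [A] may exceed the sum of the majorant; small tails are available only for the sum itself. *)
  destruct (sums_below_lim a A Ha) as [S [_ [S1 S2]]].
  destruct (S2 (eps / 3)) as [n Hn]; [lra|]. specialize (Hn n (Nat.le_refl n)).
  destruct (rlim_Csum F zeta w n Hw (eps / 3)) as [d [D H1]]; [lra|].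
  exists d. split; [assumption|]. intros r Hr. specialize (H1 r Hr).
  pose proof (Cseries_tail (fun k => F k (r * zeta)%C) a S n S1 (fun k => HF k r ltac:(lra))) as T1.
  pose proof (Cseries_tail w a S n S1 HW) as T2.
  replace (Cseries (fun k => F k (r * zeta)%C) - Cseries w)%C with
    ((Cseries (fun k => F k (r * zeta)%C) - Csum (fun k => F k (r * zeta)%C) n)
     + (Csum (fun k => F k (r * zeta)%C) n - Csum w n) - (Cseries w - Csum w n))%C by ring.
  eapply Rle_lt_trans; [apply Cmod_sub_le|].
  eapply Rle_lt_trans; [apply Rplus_le_compat_r, Cmod_triangle|]. lra.
Qed.

Lemma Cmod_inv_le_1 (z : C) : 1 <= Re z -> Cmod (/ z)%C <= 1 /\ 0 < Re (/ z)%C.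
Proof.
  intros H. split; [|apply Re_inv_pos; lra].
  rewrite Cmod_inv by (apply Re_pos_neq_0; lra). pose proof (Re_le_Cmod z).
  rewrite <- Rinv_1. apply Rinv_le_contravar; lra.
Qed.

(** On [Re >= 1] inversion is 1-Lipschitz, so the same [d] serves. *)
Lemma rlim_inv F zeta a : (forall r, 0 <= r < 1 -> 1 <= Re (F (r * zeta)%C)) -> rlim F zeta a ->
  rlim (fun z => / F z)%C zeta (/ a)%C.
Proof.
  intros HF Ha eps He. pose proof (rlim_Re_ge F zeta a 1 HF Ha) as Ra.
  destruct (Ha eps He) as [d [D H1]]. exists d. split; [assumption|]. intros r Hr.
  specialize (H1 r Hr). specialize (HF r ltac:(lra)).
  replace (/ F (r * zeta) - / a)%C with (- ((F (r * zeta) - a) * (/ F (r * zeta) * / a)))%C.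
  - rewrite Cmod_opp. eapply Rle_lt_trans; [|exact H1].
    eapply Rle_trans; [apply Cmod_mult_le; [apply Rle_refl|]|].
    + apply Cmod_mult_le; apply Cmod_inv_le_1; assumption.
    + right; ring.
  - field. split; apply Re_pos_neq_0; lra.
Qed.

(** * Dichotomy for the reciprocal of a sum *)

Section ReciprocalSum.
Variables (G : nat -> C -> C) (e q : nat -> R) (b : R -> R) (A : R).
Hypothesis G_an : forall m, analytic 1 (G m).
Hypothesis G_Re : forall m z, Cmod z <= 1 -> 0 <= Re (G m z).
Hypothesis G_dom : forall m zeta r, Cmod zeta = 1 -> 0 <= r < 1 ->
  Cmod (G m (r * zeta)%C) <= 5 * Re (G m zeta) + e m.
Hypothesis G_q : forall m rad, rad < 1 -> qana rad (q m * b rad) (G m).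
Hypothesis He : sums_below e A.
Hypothesis Hq : sums_below q 1.
Hypothesis Hb : forall rad, rad < 1 -> 0 <= b rad.

Let g (z : C) : C := (Cseries (fun m => G m z) + 1)%C.
Let f (z : C) : C := (/ g z)%C.

Let q_below (rad : R) : rad < 1 -> sums_below (fun m => q m * b rad) (b rad).
Proof.
  intros Hr. destruct Hq as [Q1 Q2]. pose proof (Hb rad Hr). split.
  - intros k. apply Rmult_le_pos; auto.
  - intros n. apply Rle_trans with (Rsum (fun m => b rad * q m) n).
    + apply Rsum_le. intros; right; ring.
    + rewrite Rsum_scal. specialize (Q2 n). nra.
Qed.

Let G_bound (z : C) : Cmod z < 1 -> forall m, Cmod (G m z) <= q m * b (Cmod z).
Proof. intros Hz m. destruct (G_q m (Cmod z) Hz) as [G' [H1 _]]. apply H1. lra. Qed.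

Let g_Re (z : C) n : Cmod z < 1 -> 1 + Rsum (fun m => Re (G m z)) n <= Re (g z).
Proof.
  intros Hz. unfold g. rewrite re_plus, re_RtoC.
  pose proof (Cseries_Re_ge (fun m => G m z) _ _ n (q_below _ Hz) (G_bound z Hz)
    (fun m => G_Re m z ltac:(lra))). lra.
Qed.

Let g_Re1 (z : C) : Cmod z < 1 -> 1 <= Re (g z).
Proof. intros Hz. pose proof (g_Re z O Hz) as H. cbn [Rsum] in H. lra. Qed.

Let f_bound (z : C) : Cmod z < 1 -> Cmod (f z) <= 1 /\ 0 < Re (f z).
Proof. intros Hz. apply Cmod_inv_le_1, g_Re1, Hz. Qed.

Let f_qana (rad : R) : rad < 1 -> qana rad (1 + (b rad + 1) + 9 * (b rad + 1) ^ 2) f.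
Proof.
  intros Hr. pose proof (Hb rad Hr). apply qana_inv; try lra.
  - apply qana_weaken with (b rad + Cmod 1); [rewrite Cmod_1; lra|].
    apply qana_add; [|apply qana_const].
    apply qana_Cseries with (fun m => q m * b rad); [apply q_below, Hr | intros; apply G_q, Hr].
  - intros z Hz. pose proof (g_Re1 z ltac:(lra)). pose proof (Re_le_Cmod (g z)). lra.
Qed.

(** A partial sum with large real part at [zeta] keeps it nearby on the radius, and all further
    terms have nonnegative real part, so [Re g] is large there. *)
Let f_lim_inf (zeta : C) : Cmod zeta = 1 -> (forall L, exists n, L < Rsum (fun m => Re (G m zeta)) n) ->
  rlim f zeta 0.
Proof.
  intros Hz HL eps Heps. destruct (HL (/ eps + 1)) as [n Hn].
  destruct (rlim_Csum G zeta (fun m => G m zeta) n (fun m => rlim_analytic _ _ (G_an m) Hz) 1 Rlt_0_1)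
    as [d [D H1]].
  exists d. split; [assumption|]. intros r Hr. specialize (H1 r Hr).
  assert (Hr1 : Cmod (r * zeta)%C < 1) by (rewrite Cmod_radial; lra).
  pose proof (Re_le_Cmod (Csum (fun m => G m zeta) n - Csum (fun k => G k (r * zeta)%C) n)%C) as Q.
  rewrite Cmod_sub_sym, re_minus, !Re_Csum in Q.
  pose proof (g_Re (r * zeta)%C n Hr1) as Q1.
  assert (I : 0 < / eps) by (apply Rinv_0_lt_compat; assumption).
  assert (B : / eps < Cmod (g (r * zeta)%C)).
  { pose proof (Re_le_Cmod (g (r * zeta)%C)). lra. }
  unfold f. replace (/ g (r * zeta) - 0)%C with (/ g (r * zeta))%C by ring.
  rewrite Cmod_inv by (apply Cmod_gt_0; lra).
  rewrite <- (Rinv_inv eps). apply Rinv_lt_contravar; [apply Rmult_lt_0_compat; lra | exact B].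
Qed.

(** The majorant [5 * Re (G m zeta) + e m] does not depend on [r] and is summable here, so the
    series converges along the radius to a limit of real part at least [1]. *)
Let f_lim_fin (zeta : C) B : Cmod zeta = 1 -> (forall n, Rsum (fun m => Re (G m zeta)) n <= B) ->
  exists w, 0 < Re w /\ rlim f zeta w.
Proof.
  intros Hz HB. set (a := fun m => 5 * Re (G m zeta) + e m). destruct He as [E1 E2].
  assert (Ha : sums_below a (5 * B + A)).
  { split.
    - intros k. unfold a. pose proof (G_Re k zeta ltac:(lra)). specialize (E1 k). lra.
    - intros n. unfold a. rewrite Rsum_plus, Rsum_scal. specialize (HB n). specialize (E2 n). lra. }
  assert (HG : rlim g zeta (Cseries (fun m => G m zeta) + 1)%C).
  { apply rlim_add; [|apply rlim_const]. apply rlim_Cseries with a (5 * B + A); [assumption | |].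
    - intros k r Hr. apply G_dom; assumption.
    - intros k. apply rlim_analytic; [apply G_an | assumption]. }
  assert (HR : forall r, 0 <= r < 1 -> 1 <= Re (g (r * zeta)%C)).
  { intros r Hr. apply g_Re1. rewrite Cmod_radial; lra. }
  exists (/ (Cseries (fun m => G m zeta) + 1))%C. split.
  - apply Re_inv_pos. pose proof (rlim_Re_ge g zeta _ 1 HR HG). lra.
  - apply rlim_inv; assumption.
Qed.

Lemma reciprocal_sum : exists f : C -> C,
  (forall z, Cmod z < 1 -> Cmod (f z) <= 1 /\ 0 < Re (f z)) /\
  (forall rad, rad < 1 -> qana rad (1 + (b rad + 1) + 9 * (b rad + 1) ^ 2) f) /\
  (forall zeta, Cmod zeta = 1 -> (forall L, exists n, L < Rsum (fun m => Re (G m zeta)) n) -> rlim f zeta 0) /\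
  (forall zeta B, Cmod zeta = 1 -> (forall n, Rsum (fun m => Re (G m zeta)) n <= B) ->
     exists w, 0 < Re w /\ rlim f zeta w).
Proof. exists f. auto. Qed.

End ReciprocalSum.

(** * Covering a null set by finite blocks of arcs *)

Lemma mass_app V W : mass (V ++ W) = mass V + mass W.
Proof. unfold mass. induction V as [|b V IH]; simpl; [ring|]. rewrite IH. ring. Qed.

Fixpoint block (l : nat -> list (C * R)) (lo k : nat) : list (C * R) :=
  match k with O => nil | S k => block l lo k ++ l (lo + k)%nat end.

Lemma block_mass l rho lo k : (forall n, mass (l n) <= rho n) ->
  mass (block l lo k) <= Rsum rho (lo + k) - Rsum rho lo.
Proof.
  intros H. induction k as [|k IH]; simpl.
  - rewrite Nat.add_0_r. unfold mass; simpl. lra.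
  - rewrite mass_app, Nat.add_succ_r. simpl. specialize (H (lo + k)%nat). lra.
Qed.

Lemma in_block l lo k b : In b (block l lo k) <-> exists i, (i < k)%nat /\ In b (l (lo + i)%nat).
Proof.
  induction k as [|k IH]; simpl.
  - split; [tauto|]. intros [i [Hi _]]. lia.
  - rewrite in_app_iff, IH. split.
    + intros [[i [Hi Hb]]|Hb]; [exists i | exists k]; split; auto.
    + intros [i [Hi Hb]]. destruct (Nat.eq_dec i k) as [->|Hne]; [right; assumption|].
      left. exists i. split; [lia | assumption].
Qed.

Lemma Rsum_sum_f_R0 a N : Rsum a (S N) = sum_f_R0 a N.
Proof. induction N as [|N IH]; [simpl; ring|]. change (Rsum a (S N) + a (S N) = sum_f_R0 a N + a (S N)). rewrite IH. reflexivity. Qed.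

(** A single cover of total length governed by [eta 0] is cut into consecutive blocks; the later
    ones are pieces of small tails. Each interval meeting [F] becomes one arc centred at a point of
    [F], which gives control over the location of the arcs. The radius [2 * (b n - a n)] reflects
    the Lipschitz constant of [expi]. *)
Lemma null_cover (F : C -> Prop) (eta : nat -> R) : (forall s, 0 < eta s) -> arc_null F ->
  exists V : nat -> list (C * R),
    (forall s, List.Forall arc (V s) /\ mass (V s) <= eta s /\ forall b, In b (V s) -> F (fst b)) /\
    forall zeta, Cmod zeta = 1 -> F zeta -> exists s, covers (V s) zeta.
Proof.
  intros Heta HF.
  destruct (HF (eta O / 2)) as [a [b [H1 [H2 H3]]]]; [specialize (Heta O); lra|].
  set (rho := fun n => 2 * (b n - a n)).
  assert (Hrho : sums_below rho (eta O)).
  { split; [intros k; specialize (H1 k); unfold rho; lra|].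
    intros [|n]; [specialize (Heta O); simpl; lra|].
    unfold rho. rewrite Rsum_scal, Rsum_sum_f_R0. specialize (H3 n). lra. }
  destruct (sums_below_lim _ _ Hrho) as [S [S0 [[S1 S2] S3]]].
  destruct (exists_fun (fun n (l : list (C * R)) => List.Forall arc l /\ mass l <= rho n /\
    (forall b, In b l -> F (fst b)) /\
    forall t, a n < t < b n -> F (expi t) -> covers l (expi t))) as [l Hl].
  { intros n. destruct (classic (exists t, a n < t < b n /\ F (expi t))) as [[t [Ht Ft]]|NE].
    - exists [(expi t, rho n)]. split; [|split; [|split]].
      + constructor; [|constructor]. split; simpl; [apply Cmod_expi | unfold rho; lra].
      + unfold mass; simpl. lra.
      + intros c [<-|[]]. exact Ft.
      + intros t' Ht' _. apply Exists_cons_hd. simpl. eapply Rle_trans; [apply expi_lip|].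
        unfold rho. apply Rmult_le_compat_l; [lra|]. apply Rabs_le. lra.
    - exists nil. split; [constructor|]. split; [apply S1|]. split; [intros c []|].
      intros t Ht Ft. exfalso. apply NE. exists t. tauto. }
  destruct (exists_fun (fun s N => forall n, (N <= n)%nat -> S - Rsum rho n < eta s)) as [Nt HNt].
  { intros s. apply S3, Heta. }
  (* [M 0 = 0], where the whole sum is already at most [eta 0]; the successor in the maximum makes
     [M] strictly increasing, so that the blocks exhaust all indices. *)
  set (M := fix M s := match s with O => O | Datatypes.S s' =>
    Nat.max (Datatypes.S (M s')) (Nt (Datatypes.S s')) end).
  assert (HM : forall s, S - Rsum rho (M s) <= eta s).
  { intros [|s]; [simpl; lra|]. left. apply HNt. apply Nat.le_max_r. }
  assert (HM2 : forall s, (M s < M (Datatypes.S s))%nat) by (intros s; apply Nat.le_max_l).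
  exists (fun s => block l (M s) (M (Datatypes.S s) - M s)). split.
  - intros s. split; [|split].
    + apply List.Forall_forall. intros c Hc. apply in_block in Hc. destruct Hc as [i [_ Hc]].
      destruct (Hl (M s + i)%nat) as [A _]. rewrite List.Forall_forall in A. exact (A c Hc).
    + eapply Rle_trans; [apply (block_mass l rho); intros n; apply Hl|].
      specialize (HM s). specialize (S2 (M s + (M (Datatypes.S s) - M s))%nat). lra.
    + intros c Hc. apply in_block in Hc. destruct Hc as [i [_ Hc]]. exact (proj1 (proj2 (proj2 (Hl _))) c Hc).
  - intros zeta Hz Fz. destruct (expi_surj zeta Hz) as [t [Ht ->]].
    destruct (H2 t Ht Fz) as [n Hn].
    assert (Q : forall k, (n < M k)%nat -> exists s, (M s <= n < M (Datatypes.S s))%nat).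
    { induction k as [|k IH]; intros Hk; [simpl in Hk; lia|].
      destruct (Nat.lt_ge_cases n (M k)) as [L|L]; [apply IH, L|]. exists k. lia. }
    assert (Q1 : forall k, (k <= M k)%nat).
    { induction k as [|k IH]; [lia|]. specialize (HM2 k). lia. }
    destruct (Q (Datatypes.S n)) as [s Hs]; [specialize (Q1 (Datatypes.S n)); lia|].
    exists s. pose proof (proj2 (proj2 (proj2 (Hl n))) t Hn Fz) as HC. unfold covers in *.
    apply List.Exists_exists in HC. destruct HC as [c [C1 C2]]. apply List.Exists_exists.
    exists c. split; [|assumption]. apply in_block. exists (n - M s)%nat. split; [lia|].
    replace (M s + (n - M s))%nat with n by lia. assumption.
Qed.

Lemma arc_null_subset (F F' : C -> Prop) : (forall z, F' z -> F z) -> arc_null F -> arc_null F'.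
Proof.
  intros H HF eps He. destruct (HF eps He) as [a [b [H1 [H2 H3]]]]. exists a, b.
  split; [assumption|]. split; [|assumption]. intros t Ht Ft. apply H2; [assumption | apply H, Ft].
Qed.

Lemma Cmod_Defs (z : C) : Defs.Cmod z = Cmod z.
Proof. unfold Defs.Cmod, Cmod. f_equal. ring. Qed.

Lemma Rsum_unbounded (u : nat -> R) (c : R) : 0 < c -> (forall k, 0 <= u k) ->
  (forall M, exists m, (M <= m)%nat /\ c <= u m) -> forall L, exists n, L < Rsum u n.
Proof.
  intros Hc Hu H L.
  assert (Q : forall k, exists n, INR k * c <= Rsum u n).
  { induction k as [|k [n Hn]]; [exists O; simpl; lra|].
    destruct (H n) as [m [Hm1 Hm2]]. exists (S m). rewrite S_INR. simpl.
    pose proof (Rsum_mono u n m Hu Hm1). lra. }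
  destruct (INR_unbounded (L / c)) as [k Hk]. destruct (Q k) as [n Hn]. exists n.
  apply Rlt_le_trans with (INR k * c); [|assumption].
  replace L with (L / c * c) at 1 by (field; lra). apply Rmult_lt_compat_r; lra.
Qed.

(** * One null set inside one open set *)

Definition half_pow (m : nat) : R := / 2 ^ S m.

Lemma half_pow_pos m : 0 < half_pow m.
Proof. apply Rinv_0_lt_compat, pow_lt. lra. Qed.

Lemma Rsum_half_pow n : Rsum half_pow n = 1 - / 2 ^ n.
Proof.
  induction n as [|n IH]; simpl Rsum; [simpl; lra|]. rewrite IH. unfold half_pow. simpl.
  assert (0 < 2 ^ n) by (apply pow_lt; lra). field. lra.
Qed.

Lemma half_pow_sums : sums_below half_pow 1.
Proof.
  split; [intros k; left; apply half_pow_pos|]. intros n. rewrite Rsum_half_pow.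
  assert (0 < / 2 ^ n) by (apply Rinv_0_lt_compat, pow_lt; lra). lra.
Qed.

Lemma half_pow_le_1 m : half_pow m <= 1.
Proof.
  unfold half_pow. rewrite <- Rinv_1. apply Rinv_le_contravar; [lra|]. apply pow_R1_Rle. lra.
Qed.

(** Independent of the null set and of the open set, so that countably many such functions can be
    summed with one constant. *)
Definition null_bound (rad : R) : R := 1 + (bump_bound rad + 1) + 9 * (bump_bound rad + 1) ^ 2.

(* The arc blocks are indexed by pairs [(i, s)]: block [s] of a cover of the points of [F] at distance
   at least [1 / (i + 1)] from the complement of [U]. *)
Lemma vanishing_on_null_set (F U : C -> Prop) : (forall z, F z -> Cmod z = 1) -> (forall z, F z -> U z) ->
  rel_open_T U -> arc_null F ->
  exists f : C -> C,
    (forall z, Cmod z < 1 -> Cmod (f z) <= 1 /\ 0 < Re (f z)) /\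
    (forall rad, rad < 1 -> qana rad (null_bound rad) f) /\
    (forall zeta, F zeta -> rlim f zeta 0) /\
    (forall zeta, Cmod zeta = 1 -> exists w, rlim f zeta w) /\
    (forall zeta, Cmod zeta = 1 -> ~ U zeta -> exists w, 0 < Re w /\ rlim f zeta w).
Proof.
  intros HFT HFU HU HF.
  (* Geometric growth makes the errors [6 / N] sum to at most [12 / 5], and the factor [5] meets the
     lower bound in [averaged_bump]. *)
  set (N := fun m => (5 * 2 ^ m)%nat).
  assert (HN : forall m, (5 <= N m)%nat).
  { intros m. unfold N. pose proof (Nat.pow_nonzero 2 m). lia. }
  destruct (exists_fun _ (fun m => averaged_bump (N m) (HN m))) as [K HK].
  set (dist := fun i => / (INR i + 1)).
  assert (Hdist : forall i, 0 < dist i <= 1).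
  { intros i. unfold dist. pose proof (pos_INR i). split; [apply Rinv_0_lt_compat; lra|].
    rewrite <- Rinv_1. apply Rinv_le_contravar; lra. }
  (* Openness of [U] makes [F] the union of these increasing sets. The masses below carry the factor
     [dist i] to offset the division by the distance in the locality clause of [averaged_bump]. *)
  set (Fi := fun i z => F z /\ forall q, Cmod q = 1 -> ~ U q -> dist i <= Cmod (q - z)%C).
  destruct (exists_fun (fun i (V : nat -> list (C * R)) =>
    (forall s, List.Forall arc (V s) /\ mass (V s) <= / K (to_nat (i, s)) * (half_pow (to_nat (i, s)) * dist i) /\
       forall b, In b (V s) -> Fi i (fst b)) /\
    forall zeta, Cmod zeta = 1 -> Fi i zeta -> exists s, covers (V s) zeta)) as [V HV].
  { intros i. apply (null_cover (Fi i) (fun s => / K (to_nat (i, s)) * (half_pow (to_nat (i, s)) * dist i))).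
    - intros s. apply Rmult_lt_0_compat; [apply Rinv_0_lt_compat, HK|].
      apply Rmult_lt_0_compat; [apply half_pow_pos | apply Hdist].
    - apply arc_null_subset with F; [intros z Hz; apply Hz | assumption]. }
  set (W := fun m => V (fst (of_nat m)) (snd (of_nat m))).
  assert (HW : forall m, List.Forall arc (W m) /\ K m * mass (W m) <= half_pow m * dist (fst (of_nat m)) /\
    forall b, In b (W m) -> Fi (fst (of_nat m)) (fst b)).
  { intros m. unfold W. destruct (HV (fst (of_nat m))) as [H1 _].
    destruct (H1 (snd (of_nat m))) as [H2 [H3 H4]].
    rewrite <- surjective_pairing, cancel_to_of in H3.
    split; [assumption|]. split; [|assumption].
    destruct (HK m) as [Kp _]. apply Rmult_le_compat_l with (r := K m) in H3; [|lra].
    rewrite <- Rmult_assoc, Rinv_r in H3 by lra. lra. }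
  assert (HWq : forall m, K m * mass (W m) <= half_pow m).
  { intros m. destruct (HW m) as [_ [H _]]. pose proof (Hdist (fst (of_nat m))). pose proof (half_pow_pos m). nra. }
  destruct (exists_fun _ (fun m => proj2 (HK m) (W m) (proj1 (HW m))
    (Rle_trans _ _ _ (HWq m) (half_pow_le_1 m)))) as [G HG].
  assert (Nm : forall m, 6 / INR (N m) = 12 / 5 * half_pow m).
  { intros m. unfold N, half_pow. rewrite mult_INR, pow_INR. simpl.
    assert (0 < 2 ^ m) by (apply pow_lt; lra). replace (1 + 1 + 1 + 1 + 1) with 5 by ring.
    replace (1 + 1) with 2 by ring. field. lra. }
  destruct (reciprocal_sum G (fun m => 6 / INR (N m)) half_pow bump_bound (12 / 5)) as [f [F1 [F2 [F3 F4]]]].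
  - intros m. apply (HG m).
  - intros m. apply (HG m).
  - intros m. apply (HG m).
  - intros m rad Hr. apply qana_weaken with (K m * mass (W m) * bump_bound rad); [|apply (HG m), Hr].
    apply Rmult_le_compat_r; [apply bump_bound_pos, Hr | apply HWq].
  - split.
    + intros m. rewrite Nm. pose proof (half_pow_pos m). lra.
    + intros n. apply Rle_trans with (Rsum (fun m => 12 / 5 * half_pow m) n).
      * apply Rsum_le. intros k _. rewrite Nm. lra.
      * rewrite Rsum_scal. pose proof (proj2 half_pow_sums n). lra.
  - exact half_pow_sums.
  - apply bump_bound_pos.
  - exists f. split; [exact F1|]. split; [exact F2|]. split; [|split].
    + intros zeta Fz. pose proof (HFT zeta Fz) as Hz. apply F3; [assumption|].
      apply Rsum_unbounded with (1 / 5); [lra | intros k; apply (HG k); lra |].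
      intros M. destruct (HU zeta) as [eps [He HUe]].
      { unfold on_circle. rewrite Cmod_Defs. exact Hz. }
      { apply HFU, Fz. }
      destruct (archimed_cor1 eps He) as [i0 [I1 I2]].
      (* Every [i >= i0] puts [zeta] into [Fi i]; taking also [i >= M] gives a pair code at least
         [M], so terms at least [1 / 5] occur at arbitrarily large indices. *)
      set (i := Nat.max i0 M).
      assert (Fiz : Fi i zeta).
      { split; [assumption|]. intros q Hq NU. apply Rnot_lt_le. intros L. apply NU.
        apply HUe; [unfold on_circle; rewrite Cmod_Defs; exact Hq|].
        rewrite Cmod_Defs. change (Csub q zeta) with (q - zeta)%C.
        eapply Rlt_trans; [exact L|]. eapply Rle_lt_trans; [|exact I1]. unfold dist.
        apply Rinv_le_contravar; [apply lt_0_INR; assumption|].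
        assert (INR i0 <= INR i) by (apply le_INR; unfold i; lia). lra. }
      destruct (proj2 (HV i) zeta Hz Fiz) as [s Hs].
      exists (to_nat (i, s)). split.
      * pose proof (to_nat_non_decreasing i s). unfold i in *. lia.
      * apply (HG (to_nat (i, s))); [assumption|]. unfold W. rewrite cancel_of_to. exact Hs.
    + intros zeta Hz.
      (* On [U] outside [F] either alternative can occur, and each yields a limit. *)
      destruct (classic (forall L, exists n, L < Rsum (fun m => Re (G m zeta)) n)) as [HL|HL].
      * exists (RtoC 0). apply F3; assumption.
      * apply not_all_ex_not in HL. destruct HL as [B HB].
        destruct (F4 zeta B Hz) as [w [_ Hw]]; [|exists w; exact Hw].
        intros n. apply Rnot_lt_le. intros L. apply HB. exists n. exact L.
    (* Off [U] all centres of [W m] are at distance at least the corresponding [dist], so locality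
       bounds the term by [half_pow m] and the sum by [1]. *)
    + intros zeta Hz NU. apply (F4 zeta 1 Hz). intros n.
      apply Rle_trans with (Rsum half_pow n); [|apply half_pow_sums].
      apply Rsum_le. intros m _.
      destruct (HW m) as [_ [W1 W2]]. pose proof (Hdist (fst (of_nat m))) as Hd.
      eapply Rle_trans; [apply Re_le_Cmod|].
      destruct (HG m) as [_ [_ [_ [_ [_ HG6]]]]].
      eapply Rle_trans; [apply (HG6 zeta (dist (fst (of_nat m))) Hz (proj1 Hd))|].
      * intros c Hc. apply (W2 c Hc); assumption.
      * pose proof (half_pow_le_1 m). nra.
      * apply Rle_div_l; [lra | exact W1].
Qed.

(** * Return to the original definitions and the sum over all open sets *)

Lemma radial_limit_iff_rlim (f : C -> C) (zeta w : C) : radial_limit f zeta w <-> rlim f zeta w.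
Proof.
  assert (E : forall r, Defs.Cmod (Csub (f (Cscal r zeta)) w) = Cmod (f (r * zeta) - w)%C).
  { intros r. rewrite Cmod_Defs. change (Csub (f (Cscal r zeta)) w) with (f (Cscal r zeta) - w)%C.
    replace (Cscal r zeta) with (r * zeta)%C; [reflexivity|].
    unfold Cscal. destruct zeta. unfold Cmult. simpl. f_equal; ring. }
  split; intros H eps He; destruct (H eps He) as [d [Hd H1]].
  - exists (Rmin d 1). pose proof (Rmin_l d 1). split.
    + split; [apply Rmin_pos; lra | apply Rmin_r].
    + intros r Hr. rewrite <- E. apply H1. lra.
  - exists d. split; [lra|]. intros r Hr. rewrite E. apply H1, Hr.
Qed.

Lemma qana_differentiable (f : C -> C) (M : R -> R) : (forall rad, rad < 1 -> qana rad (M rad) f) ->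
  forall z, Cmod z < 1 -> C_differentiable_at f z.
Proof.
  (* The radius halfway to the circle leaves room for increments; a remainder [M rad * |h|^2] is at
     most [eps * |h|] once [|h|] is small. *)
  intros H z Hz. pose proof (Cmod_ge_0 z). set (rad := (1 + Cmod z) / 2).
  destruct (H rad ltac:(unfold rad; lra)) as [f' [H1 H2]].
  assert (HM : 0 <= M rad).
  { eapply Rle_trans; [apply Cmod_ge_0 | apply (H1 z)]. unfold rad. lra. }
  exists (f' z). intros eps He. exists (Rmin (rad - Cmod z) (eps / (M rad + 1))). split.
  - apply Rmin_pos; [unfold rad; lra | apply Rdiv_lt_0_compat; lra].
  - intros h Hh. rewrite !Cmod_Defs in *.
    change (Cmod (f (z + h) - f z - f' z * h)%C <= eps * Cmod h).
    pose proof (Rmin_l (rad - Cmod z) (eps / (M rad + 1))).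
    pose proof (Rmin_r (rad - Cmod z) (eps / (M rad + 1))).
    pose proof (Cmod_triangle z h). pose proof (Cmod_ge_0 h).
    specialize (H2 z (z + h)%C ltac:(unfold rad; lra) ltac:(lra)).
    assert (E : forall a b : C, (a + b - a)%C = b) by (intros; ring). rewrite E in H2.
    eapply Rle_trans; [exact H2|].
    replace (M rad * Cmod h ^ 2) with (M rad * Cmod h * Cmod h) by ring.
    apply Rmult_le_compat_r; [assumption|].
    apply Rle_trans with ((M rad + 1) * (eps / (M rad + 1))); [|right; field; lra].
    apply Rmult_le_compat; lra.
Qed.

Theorem theorem1 (F : Cplx -> Prop)
  (HFT : forall z, F z -> on_circle z)
  (HG : G_delta_T F)
  (Hnull : arc_null F) :
  exists f : Cplx -> Cplx,
    H_infty f /\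
    (forall z, in_disc z -> 0 < Cre (f z)) /\
    (forall zeta, on_circle zeta -> fatou_point f zeta) /\
    (forall zeta, on_circle zeta -> (radial_limit f zeta C0 <-> F zeta)).
Proof.
  assert (HC : forall z, on_circle z <-> Cmod z = 1) by (intros z; unfold on_circle; rewrite Cmod_Defs; tauto).
  assert (HD : forall z, in_disc z <-> Cmod z < 1) by (intros z; unfold in_disc; rewrite Cmod_Defs; tauto).
  destruct HG as [U [HU HFU]].
  destruct (exists_fun _ (fun n => vanishing_on_null_set F (U n) (fun z Hz => proj1 (HC z) (HFT z Hz))
    (fun z Hz => proj1 (HFU z (HFT z Hz)) Hz n) (HU n) Hnull)) as [f Hf].
  assert (Hh : forall k, Cmod (half_pow k) = half_pow k).
  { intros k. rewrite Cmod_R, Rabs_pos_eq; [reflexivity | left; apply half_pow_pos]. }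
  set (g := fun z => Cseries (fun k => (half_pow k * f k z)%C)).
  assert (Hb : forall z, Cmod z < 1 -> forall k, Cmod (half_pow k * f k z)%C <= half_pow k).
  { intros z Hz k. rewrite Cmod_mult, Hh. destruct (proj1 (Hf k) z Hz).
    pose proof (half_pow_pos k). nra. }
  assert (Hlim : forall zeta (w : nat -> C), Cmod zeta = 1 -> (forall k, rlim (f k) zeta (w k)) ->
    rlim g zeta (Cseries (fun k => (half_pow k * w k)%C))).
  { intros zeta w Hz Hw. apply rlim_Cseries with half_pow 1; [exact half_pow_sums | |].
    - intros k r Hr. apply Hb. rewrite Cmod_radial; lra.
    - intros k. apply (rlim_scal (f k)), Hw. }
  assert (Hex : forall zeta, Cmod zeta = 1 -> exists w : nat -> C, forall k, rlim (f k) zeta (w k)).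
  { intros zeta Hz. apply (exists_fun (fun k w => rlim (f k) zeta w)). intros k. apply (Hf k), Hz. }
  exists g. split; [split|split; [|split]].
  - intros z Hz. apply HD in Hz. apply qana_differentiable with null_bound; [|assumption].
    intros rad Hr. unfold g. apply qana_Cseries with (fun k => half_pow k * null_bound rad).
    + assert (0 <= null_bound rad).
      { pose proof (bump_bound_pos rad Hr). unfold null_bound. nra. }
      split.
      * intros k. pose proof (half_pow_pos k). nra.
      * intros n. apply Rle_trans with (Rsum (fun k => null_bound rad * half_pow k) n).
        -- apply Rsum_le. intros; right; ring.
        -- rewrite Rsum_scal. pose proof (proj2 half_pow_sums n). nra.
    + intros k. pose proof (qana_scal _ _ _ (RtoC (half_pow k)) (proj1 (proj2 (Hf k)) rad Hr)) as Q.
      rewrite Hh in Q. exact Q.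
  - exists 1. intros z Hz. apply HD in Hz. rewrite Cmod_Defs.
    apply Cseries_Cmod_le with half_pow; [exact half_pow_sums | apply Hb, Hz].
  - intros z Hz. apply HD in Hz. change (0 < Re (g z)).
    assert (Hr : forall k, 0 < Re (half_pow k * f k z)%C).
    { intros k. rewrite re_scal_l. apply Rmult_lt_0_compat; [apply half_pow_pos | apply (Hf k), Hz]. }
    (* The partial sum of length [1], the term of index [0] alone, already has positive real
       part. *)
    pose proof (Cseries_Re_ge (fun k => (half_pow k * f k z)%C) half_pow 1 1 half_pow_sums (Hb z Hz)
      (fun k => Rlt_le _ _ (Hr k))) as Q.
    specialize (Hr O). cbn [Rsum] in Q. unfold g. lra.
  - intros zeta Hz. apply HC in Hz. destruct (Hex zeta Hz) as [w Hw].
    eexists. apply radial_limit_iff_rlim. apply Hlim; [assumption | exact Hw].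
  - intros zeta Hz. apply HC in Hz. change C0 with (RtoC 0). rewrite radial_limit_iff_rlim. split.
    + intros H0. apply NNPP. intros NF.
      (* Outside some [U n] the [n]-th limit has positive real part and the others nonnegative real
         part, so the limit of the sum cannot be [0]. *)
      assert (NU : exists n, ~ U n zeta).
      { apply not_all_ex_not. intros HA. apply NF, HFU; [apply HC, Hz | exact HA]. }
      destruct NU as [n NU]. destruct (Hex zeta Hz) as [w Hw].
      pose proof (rlim_unique _ _ _ _ H0 (Hlim zeta w Hz Hw)) as E.
      assert (Rr : forall r, 0 <= r < 1 -> Cmod (r * zeta)%C < 1) by (intros; rewrite Cmod_radial; lra).
      assert (Wr : forall k, 0 <= Re (w k) /\ Cmod (w k) <= 1).
      { intros k. split.
        - apply (rlim_Re_ge (f k) zeta _ 0); [|apply Hw]. intros r Hr.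
          left. apply (Hf k), (Rr r Hr).
        - apply (rlim_Cmod_le (f k) zeta _ 1); [|apply Hw]. intros r Hr. apply (Hf k), (Rr r Hr). }
      assert (Wn : 0 < Re (w n)).
      { destruct (Hf n) as [_ [_ [_ [_ H5]]]]. destruct (H5 zeta Hz NU) as [w' [P1 P2]].
        rewrite (rlim_unique _ _ _ _ (Hw n) P2). exact P1. }
      assert (Dk : forall k, Cmod (half_pow k * w k)%C <= half_pow k).
      { intros k. rewrite Cmod_mult, Hh. pose proof (half_pow_pos k). destruct (Wr k). nra. }
      assert (Pk : forall k, 0 <= Re (half_pow k * w k)%C).
      { intros k. rewrite re_scal_l. apply Rmult_le_pos; [left; apply half_pow_pos | apply Wr]. }
      pose proof (Cseries_Re_ge (fun k => (half_pow k * w k)%C) half_pow 1 (S n) half_pow_sums Dk Pk) as Q.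
      cbn [Rsum] in Q. rewrite <- E in Q.
      pose proof (Rsum_ge_0 (fun k => Re (half_pow k * w k)%C) n (fun k _ => Pk k)).
      rewrite re_scal_l, re_RtoC in Q. pose proof (half_pow_pos n). nra.
    + intros Fz.
      (* On [F] every [f k] has limit [0]; the zero series has sum [0] by comparison with the zero
         majorant. *)
      replace (RtoC 0) with (Cseries (fun k => (half_pow k * (fun _ => RtoC 0) k)%C)).
      * apply Hlim; [assumption|]. intros k. apply (Hf k), Fz.
      * apply Cmod_eq_0, Rle_antisym; [|apply Cmod_ge_0].
        apply Cseries_Cmod_le with (fun _ => 0).
        -- split; [intros; lra|]. intros n. rewrite Rsum_const. lra.
        -- intros k. rewrite Cmult_0_r, Cmod_0. lra.
Qed.
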